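(* Let $G$ be a finitely generated infinite group which is recursively presented. Suppose that there exist a finite alphabet $\mathcal{A}$ and a (nonempty) subshift of finite type $X\subset \mathcal{A}^G$ with nonzero Medvedev degree. Then $G$ does not have the strong topological Rokhlin property.
   Context: Groups. Fix a finite generating set $S$ of $G$ closed under inverses. $S^\ast$ is the set of finite words on $S$, and for $w\in S^\ast$, $\underline{w}\in G$ denotes the corresponding group element. $G$ is recursively presented if $\{w\in S^\ast : \underline{w}=1_G\}$ is recursively enumerable. Strong topological Rokhlin property (STRP). Let $C$ be the Cantor space and let $\mathrm{Act}(G,C)$ be the set of actions of $G$ on $C$ by homeomorphisms, identified with $\mathrm{Hom}(G,\mathrm{Homeo}(C))\subset \mathrm{Homeo}(C)^G$, where $\mathrm{Homeo}(C)$ carries the topology of uniform convergence and $\mathrm{Act}(G,C)$ the subspace topology of the product topology. $G$ has the STRP if there is an action $\alpha\in \mathrm{Act}(G,C)$ whose topological conjugacy class $\{h\alpha h^{-1} : h\in\mathrm{Homeo}(C)\}$ contains a dense $G_\delta$ subset of $\mathrm{Act}(G,C)$. Subshifts. For a finite set $\mathcal{A}$ (alphabet), $\mathcal{A}^G$ is the set of functions $G\to\mathcal{A}$ (configurations) with the product of discrete topologies, and $G$ acts on it by $(gx)(h)=x(g^{-1}h)$. A subshift is a nonempty closed shift-invariant subset of $\mathcal{A}^G$. A pattern is a function $p\colon F\to\mathcal{A}$ with $F\subset G$ finite; it appears in $x\in\mathcal{A}^G$ if $(gx)|_F=p$ for some $g\in G$. A subshift is of finite type (SFT) if it equals $\{x\in\mathcal{A}^G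 : \text{no pattern from }\mathcal{F}\text{ appears in }x\}$ for some finite set $\mathcal{F}$ of patterns. Medvedev degree. A configuration $x\in\mathcal{A}^G$ is computable if there is a Turing machine which on input $w\in S^\ast$ halts and outputs $x(\underline{w})$. A subshift has zero Medvedev degree if and only if it contains a computable configuration; thus it has nonzero Medvedev degree if and only if it contains no computable configuration. *)

(* Defs.v *)
From HB Require Import structures.
From mathcomp Require Import all_boot all_order all_algebra.
From mathcomp Require Import finmap.
From mathcomp Require Import all_classical all_reals all_analysis.
From mathcomp Require Import borel_hierarchy.

Set Implicit Arguments.
Unset Strict Implicit.
Unset Printing Implicit Defensive.

Local Open Scope classical_set_scope.

Inductive tm_move := MoveLeft | Stay | MoveRight.

(* Deterministic multi-tape machines reading words over I and answering with a
   letter of O.  The tape alphabet is the disjoint union of I, O and a finite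
   set of auxiliary symbols, plus the blank symbol None; there are
   tm_extra.+1 tapes. *)
Definition tm_symbol (I O W : finType) : finType := option (I + O + W).

Record turing_machine (I O : finType) := TuringMachine {
  tm_state : finType;
  tm_work : finType;
  tm_extra : nat;
  tm_start : tm_state;
  tm_halting : pred tm_state;
  tm_trans :
    tm_state -> {ffun 'I_tm_extra.+1 -> tm_symbol I O tm_work} ->
    tm_state * ('I_tm_extra.+1 -> tm_symbol I O tm_work * tm_move)
}.

(* A two-way infinite tape, blank outside the listed cells: tape_left lists the
   cells to the left of the head, nearest first, and tape_right those to its
   right, nearest first. *)
Record tm_tape (T : Type) := TmTape {
  tape_left : seq T;
  tape_head : T;
  tape_right : seq T
}.

Definition tape_move (T : Type) (blank : T) (m : tm_move) (t : tm_tape T) :=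
  let: TmTape l c r := t in
  match m with
  | MoveLeft => TmTape (behead l) (head blank l) (c :: r)
  | Stay => t
  | MoveRight => TmTape (c :: l) (head blank r) (behead r)
  end.

Definition tape_write (T : Type) (a : T) (t : tm_tape T) :=
  TmTape (tape_left t) a (tape_right t).

Section Run.
Variables (I O : finType) (M : turing_machine I O).

Local Notation symbol := (tm_symbol I O (tm_work M)).
Local Notation tapes := ('I_(tm_extra M).+1 -> tm_tape symbol).

Definition tm_blank : symbol := None.
Definition tm_input (i : I) : symbol := Some (inl (inl i)).
Definition tm_output (o : O) : symbol := Some (inl (inr o)).

Definition tm_step (c : tm_state M * tapes) : tm_state M * tapes :=
  let: (q, t) := c in
  if tm_halting q then c else
  let: (q', act) := tm_trans q [ffun j => tape_head (t j)] in
  (q', fun j => tape_move tm_blank (act j).2 (tape_write (act j).1 (t j))).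

(* The input word is written on tape 0, with the head on its first letter; the
   other tapes are blank. *)
Definition tm_init (w : seq I) : tm_state M * tapes :=
  let u := map tm_input w in
  (tm_start M, fun j => if j == ord0
                        then TmTape [::] (head tm_blank u) (behead u)
                        else TmTape [::] tm_blank [::]).

Definition tm_halts (w : seq I) : Prop :=
  exists n, tm_halting (iter n tm_step (tm_init w)).1.

(* The answer is the symbol scanned on tape 0 when the machine halts. *)
Definition tm_halts_with (w : seq I) (o : O) : Prop :=
  exists n, let c := iter n tm_step (tm_init w) in
    tm_halting c.1 /\ tape_head (c.2 ord0) = tm_output o.

End Run.

Definition recursively_enumerable (I : finType) (L : set (seq I)) : Prop :=
  exists M : turing_machine I void, forall w, L w <-> tm_halts M w.

Section Words.
Variables (G : groupType) (S : {fset G}).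

Definition word_eval (w : seq S) : G := (\prod_(s <- w) val s)%g.

(* As S is closed under inverses, the subgroup it generates consists of the
   elements represented by words on S. *)
Definition symmetric_generating_set : Prop :=
  (forall s, s \in S -> (s^-1)%g \in S) /\
  (forall g, exists w, word_eval w = g).

Definition recursively_presented : Prop :=
  recursively_enumerable [set w | word_eval w = 1%g].

End Words.

Definition homeomorphism (T : topologicalType) (f : T -> T) : Prop :=
  exists f' : T -> T,
    [/\ cancel f f', cancel f' f, continuous f & continuous f'].

Definition Homeo_cantor : topologicalType :=
  set_type [set f : {uniform cantor_space -> cantor_space} | homeomorphism f].

Definition homeo_app (f : Homeo_cantor) : cantor_space -> cantor_space :=
  set_val f.

Definition is_action (G : groupType) (a : {ptws G -> Homeo_cantor}) : Prop :=
  (forall x, homeo_app (a 1%g) x = x) /\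
  (forall g h x, homeo_app (a (g * h)%g) x = homeo_app (a g) (homeo_app (a h) x)).

Definition Act_cantor (G : groupType) : topologicalType :=
  set_type [set a : {ptws G -> Homeo_cantor} | is_action a].

Definition act_app (G : groupType) (a : Act_cantor G) (g : G) :
    cantor_space -> cantor_space :=
  homeo_app (set_val a g).

Definition conjugacy_class (G : groupType) (a : Act_cantor G) :
    set (Act_cantor G) :=
  [set b | exists h h' : Homeo_cantor,
    [/\ cancel (homeo_app h) (homeo_app h'),
        cancel (homeo_app h') (homeo_app h) &
        forall g x, act_app b g x = homeo_app h (act_app a g (homeo_app h' x))]].

Definition STRP (G : groupType) : Prop :=
  exists (a : Act_cantor G) (D : set (Act_cantor G)),
    [/\ Gdelta D, dense D & D `<=` conjugacy_class a].

Definition fullshift (G : groupType) (A : finType) : topologicalType :=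
  {ptws G -> discrete_topology A}.

Section Subshifts.
Variables (G : groupType) (A : finType).

Definition shift (g : G) (x : fullshift G A) : fullshift G A :=
  fun h => x (g^-1 * h)%g.

Definition subshift (X : set (fullshift G A)) : Prop :=
  [/\ X !=set0, closed X & forall g x, X x -> X (shift g x)].

(* A pattern F -> A is a finite map, whose domain is F. *)
Definition appears (p : {fmap G -> A}) (x : fullshift G A) : Prop :=
  exists g, forall h : domf p, shift g x (val h) = p h.

Definition SFT (X : set (fullshift G A)) : Prop :=
  subshift X /\
  exists F : {fset {fmap G -> A}},
    X = [set x | forall p, p \in F -> ~ appears p x].

Variable S : {fset G}.

Definition computable (x : fullshift G A) : Prop :=
  exists M : turing_machine S A,
    forall w : seq S, tm_halts_with M w (x (word_eval w)).

Definition zero_medvedev_degree (X : set (fullshift G A)) : Prop :=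
  exists x, X x /\ computable x.

End Subshifts.

(* Main.v *)
(* If the conjugacy class of an action alpha contains a dense G_delta set, then
   the set Y of codings of an action with respect to a clopen partition takes only
   countably many values on that set, because codings of conjugates of alpha are
   codings of alpha. By a Baire category argument some value Y is attained densely
   in a basic open set N, which can be taken inside the nonempty open set of
   actions whose codings lie in X. Such an N is described by finitely many local
   rules on a finer partition, and every closed invariant set of configurations
   obeying these rules and using every letter at 1 is the set of codings of some
   action in N. Hence a pattern p occurs in Y iff, for some letter beta, no
   configuration obeying the rules has beta at 1 and avoids p. By compactness and
   since G is recursively presented, this is semidecidable, so the patterns of Y
   are recursively enumerable. Extending patterns greedily gives a computable
   configuration all of whose finite patterns occur in Y, hence one in X. *)
Require Import Defs.
From mathcomp Require Import all_boot finmap all_classical all_analysis.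
From mathcomp Require Import borel_hierarchy.

Set Implicit Arguments.
Unset Strict Implicit.
Unset Printing Implicit Defensive.

Local Open Scope classical_set_scope.

(** * Counter programs and computable functions *)

(** The codings take countably many values because a conjugating homeomorphism pulls a clopen
    partition back to a clopen partition, and the Cantor space has only countably many of these.

    The letter beta at 1 enters because a set of configurations can be the codings of an action with
    respect to a partition without empty cells only if every letter is used. Conversely an action in
    N with codings Y has points in every cell, so a single beta forcing p already puts p into Y.

    The word problem of G may be undecidable: equality of words can be confirmed but never denied.
    Hence letters are assigned to words instead of group elements, and assignments are only ever
    refuted, in stages, by evidence that persists. One-sided knowledge of the patterns of Y suffices
    for the greedy extension, since each of them extends to a longer one and no choice has to be
    revised.

    Machines stand at both ends. The machine recognising the trivial words is simulated by
    arithmetic, and the arithmetic function found in the end is turned into a machine by way of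
    counter programs. *)

Section Commands.
Variables I O : finType.

(** The first component of a program state is the unread input or, after [Put], the output letter;
    the second one holds the registers. [Scan b] consumes the input and runs [b i] on each letter
    [i]. *)
Inductive cmd :=
| Skip | Inc of nat | Dec of nat | Seq of cmd & cmd | While of nat & cmd
| Scan of (I -> cmd) | Put of O.

Definition upd (v : nat -> nat) r n := fun i => if i == r then n else v i.

Inductive exec : cmd -> (seq I + O) * (nat -> nat) -> (seq I + O) * (nat -> nat) -> Prop :=
| ExecSkip s : exec Skip s s
| ExecInc r x v : exec (Inc r) (x, v) (x, upd v r (v r).+1)
| ExecDec r x v : exec (Dec r) (x, v) (x, upd v r (v r).-1)
| ExecSeq c d s1 s2 s3 : exec c s1 s2 -> exec d s2 s3 -> exec (Seq c d) s1 s3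
| ExecWhile0 r c x v : v r = 0 -> exec (While r c) (x, v) (x, v)
| ExecWhileS r c x v s2 s3 : v r <> 0 -> exec c (x, v) s2 ->
    exec (While r c) s2 s3 -> exec (While r c) (x, v) s3
| ExecScan0 b v : exec (Scan b) (inl [::], v) (inl [::], v)
| ExecScanS b i w v s2 s3 : exec (b i) (inl w, v) s2 ->
    exec (Scan b) s2 s3 -> exec (Scan b) (inl (i :: w), v) s3
| ExecPut o x v : exec (Put o) (x, v) (inr o, v).

(** The registers from [s] on form a stack with content [l]. Since the registers above it are zero,
    a zero on top cannot be told from its absence. *)
Definition frame (v : nat -> nat) s (l : seq nat) :=
  fun i => if i < s then v i else nth 0 l (i - s).

Lemma frame_cat v s l l' : frame v s (l ++ l') = frame (frame v s l) (s + size l) l'.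
Proof.
apply: funext => i; rewrite /frame nth_cat.
case: (ltnP i s) => h; first by rewrite (leq_trans h) // leq_addr.
by rewrite ltn_subLR // subnDA.
Qed.

Lemma frame_cons v s a l : frame v s (a :: l) = frame (frame v s [:: a]) s.+1 l.
Proof. by rewrite -[a :: l]cat1s frame_cat addn1. Qed.

Lemma frame_0 v s : frame v s [:: 0] = frame v s [::].
Proof. by apply: funext => i; rewrite /frame; case: ifP => // _; case: (i - s) => [|[|]] //=; rewrite ?nth_nil. Qed.

Lemma frame_rcons0 v s l : frame v s (l ++ [:: 0]) = frame v s l.
Proof.
apply: funext => i; rewrite /frame nth_cat; case: ifP => // _.
case: ltnP => // h; rewrite [RHS]nth_default //.
by case: (i - s - _) => [|[|]].
Qed.

Lemma map_frame v s l rho : all (fun i => i < s) rho ->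
  [seq frame v s l i | i <- rho] = [seq v i | i <- rho].
Proof. by move=> /allP h; apply/eq_in_map => i /h; rewrite /frame => ->. Qed.

Lemma map_frame_iota v s l : [seq frame v s l i | i <- iota s (size l)] = l.
Proof.
apply: (@eq_from_nth _ 0); rewrite size_map size_iota // => i hi.
rewrite (nth_map 0) ?size_iota // nth_iota // /frame addKn.
by rewrite ltnNge leq_addr.
Qed.

Lemma frame_upd v s l i n : i < size l ->
  upd (frame v s l) (s + i) n = frame v s (set_nth 0 l i n).
Proof.
move=> hi; apply: funext => j; rewrite /upd /frame nth_set_nth /=.
case: (ltnP j s) => h; first by rewrite ltn_eqF // ltn_addr.
by rewrite -(subnKC h) eqn_add2l addKn.
Qed.

Lemma frame_at v s l i : frame v s l (s + i) = nth 0 l i.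
Proof. by rewrite /frame ltnNge leq_addr addKn. Qed.

Lemma frame_at0 v s l : frame v s l s = nth 0 l 0.
Proof. by rewrite -{2}[s]addn0 frame_at. Qed.

Definition clear r := While r (Dec r).

Lemma exec_clear r x v : exec (clear r) (x, v) (x, upd v r 0).
Proof.
move: {2}(v r) (erefl (v r)) => n; elim: n v => [|n IH] v hv.
  suff -> : upd v r 0 = v by apply: ExecWhile0.
  by apply: funext => i; rewrite /upd; case: eqP => // ->.
apply: ExecWhileS; [by rewrite hv | apply: ExecDec |].
suff -> : upd v r 0 = upd (upd v r (v r).-1) r 0.
  by apply: IH; rewrite /upd eqxx hv.
by apply: funext => i; rewrite /upd; case: eqP.
Qed.

Definition move r t := While r (Seq (Dec r) (Inc t)).

Lemma exec_move r t x v : r != t ->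
  exec (move r t) (x, v) (x, upd (upd v t (v t + v r)) r 0).
Proof.
move=> rt; move: {2}(v r) (erefl (v r)) => n; elim: n v => [|n IH] v hv.
  suff -> : upd (upd v t (v t + v r)) r 0 = v by apply: ExecWhile0.
  apply: funext => i; rewrite /upd; case: eqP => [->|] //.
  by case: eqP => // ->; rewrite hv addn0.
apply: ExecWhileS; [by rewrite hv | apply: ExecSeq; [apply: ExecDec | apply: ExecInc] |].
set w := upd _ t _.
have wr : w r = n by rewrite /w /upd (negbTE rt) eqxx hv.
have wt : w t = (v t).+1 by rewrite /w /upd eqxx eq_sym (negbTE rt).
suff -> : upd (upd v t (v t + v r)) r 0 = upd (upd w t (w t + w r)) r 0 by apply: IH.
rewrite wr wt hv addSnnS.
by apply: funext => i; rewrite /w /upd; case: eqP => //; case: eqP.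
Qed.

Definition copy r t u :=
  Seq (While r (Seq (Dec r) (Seq (Inc t) (Inc u)))) (move u r).

Lemma exec_copy r t u x v : r != t -> r != u -> t != u -> v t = 0 -> v u = 0 ->
  exec (copy r t u) (x, v) (x, upd v t (v r)).
Proof.
move=> rt ru tu vt vu.
pose w := upd (upd (upd v t (v r)) u (v r)) r 0.
apply: (@ExecSeq _ _ _ (x, w)); last first.
  suff -> : upd v t (v r) = upd (upd w r (w r + w u)) u 0.
    by apply: exec_move; rewrite eq_sym.
  apply: funext => i; rewrite /w /upd !eqxx; case: (eqVneq i t) => [->|it].
    by rewrite (negbTE tu) eq_sym (negbTE rt).
  case: eqP => [->|_] //; case: eqP => [->|_] //.
  by rewrite eq_sym (negbTE ru) add0n.
suff H n v' : v' r = n -> v' t = v' u -> exec (While r (Seq (Dec r) (Seq (Inc t) (Inc u)))) (x, v')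
   (x, upd (upd (upd v' t (v' t + n)) u (v' t + n)) r 0).
  by have := H _ v erefl; rewrite vt vu; apply.
elim: n v' => [|n IH] v' hv htu.
  suff -> : upd (upd (upd v' t (v' t + 0)) u (v' t + 0)) r 0 = v' by apply: ExecWhile0.
  apply: funext => i; rewrite /upd addn0; case: eqP => [->|] //.
  by case: eqP => [-> //|] _; case: eqP => [->|].
apply: ExecWhileS; [by rewrite hv | apply: ExecSeq; [apply: ExecDec | apply: ExecSeq; apply: ExecInc] |].
set w' := upd _ u _.
have wr : w' r = n by rewrite /w' /upd (negbTE rt) (negbTE ru) eqxx hv.
have tr : (t == r) = false by rewrite eq_sym (negbTE rt).
have ur : (u == r) = false by rewrite eq_sym (negbTE ru).
have ut : (u == t) = false by rewrite eq_sym (negbTE tu).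
have wt : w' t = (v' t).+1 by rewrite /w' /upd (negbTE tu) eqxx tr.
have wu : w' u = (v' t).+1 by rewrite /w' /upd eqxx ut ur htu.
have := IH w' wr; rewrite wt wu addSnnS => /(_ erefl).
congr (exec _ _ (_, _)).
by apply: funext => i; rewrite /w' /upd; case: eqP => //; case: eqP => //; case: eqP.
Qed.

(* f is computed by counter programs that push the result on a frame; rho
   gives the addresses of the registers holding the arguments. *)
Definition rec (f : seq nat -> nat) :=
  forall rho s, all (fun i => i < s) rho -> exists c, forall x v,
    exec c (x, frame v s [::]) (x, frame v s [:: f [seq v i | i <- rho]]).

Lemma rec_ext f g : f =1 g -> rec f -> rec g.
Proof. by move=> /funext ->. Qed.

Lemma rec_var i : rec (fun e => nth 0 e i).
Proof.
move=> rho s hs; case: (ltnP i (size rho)) => hi; last first.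
  exists Skip => x v; rewrite nth_default ?size_map // frame_0; exact: ExecSkip.
have hr : nth 0 rho i < s by move/all_nthP: hs; apply.
exists (copy (nth 0 rho i) s s.+1) => x v.
suff -> : frame v s [:: nth 0 [seq v i | i <- rho] i] =
          upd (frame v s [::]) s (frame v s [::] (nth 0 rho i)).
  apply: exec_copy; rewrite /frame ?ltnn ?nth_nil ?ltnNge ?leqnSn ?nth_nil //.
  - by rewrite ltn_eqF.
  - by rewrite ltn_eqF // leqW.
  - by rewrite ltn_eqF.
rewrite {3}/frame hr (nth_map 0) //.
apply: funext => j; rewrite /upd /frame; case: (ltngtP j s) => //.
  by move=> h; rewrite -(subnSK h) /= !nth_nil.
by move=> ->; rewrite subnn.
Qed.

Lemma rec_zero : rec (fun=> 0).
Proof. by move=> rho s hs; exists Skip => x v; rewrite frame_0; exact: ExecSkip. Qed.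

Lemma rec_succ f : rec f -> rec (fun e => (f e).+1).
Proof.
move=> hf rho s hs; have [c hc] := hf rho s hs.
exists (Seq c (Inc s)) => x v; apply: ExecSeq; first exact: hc.
set l := [:: f _].
have := @ExecInc s x (frame v s l).
by rewrite frame_at0 -[X in upd _ X]addn0 frame_upd.
Qed.

Lemma exec_evals (gs : seq (seq nat -> nat)) : (forall i, i < size gs -> rec (nth (fun=> 0) gs i)) ->
  forall rho s, all (fun i => i < s) rho -> exists c, forall x v,
    exec c (x, frame v s [::]) (x, frame v s [seq g [seq v i | i <- rho] | g <- gs]).
Proof.
elim: gs => [|g gs IH] hgs rho s hs.
  by exists Skip => x v; exact: ExecSkip.
have [c1 h1] := hgs 0 isT rho s hs.
have hs' : all (fun i => i < s.+1) rho.
  by apply: sub_all hs => i; exact: leqW.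
have [c2 h2] := IH (fun i hi => hgs i.+1 hi) rho s.+1 hs'.
exists (Seq c1 c2) => x v; apply: ExecSeq; first exact: h1.
have := h2 x (frame v s [:: g [seq v i | i <- rho]]).
by rewrite map_frame // -!frame_cons.
Qed.

(** Values are computed on top of the data they depend on, so what has to go is the lowest entry, at
    [s]; the [k] entries above it move down by one. *)
Fixpoint pop s k := Seq (clear s) (if k is k'.+1 then Seq (move s.+1 s) (pop s.+1 k') else Skip).

Lemma exec_pop s a l x v : exec (pop s (size l)) (x, frame v s (a :: l)) (x, frame v s l).
Proof.
elim: l s a v => [|b l IH] s a v /=; apply: ExecSeq; try exact: exec_clear.
  suff -> : upd (frame v s [:: a]) s 0 = frame v s [::] by exact: ExecSkip.
  by rewrite -[X in upd _ X]addn0 frame_upd //= frame_0.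
apply: ExecSeq; first by apply: exec_move; rewrite gtn_eqF.
have -> : upd (frame v s [:: a, b & l]) s 0 = frame v s [:: 0, b & l].
  by rewrite -[X in upd _ X]addn0 frame_upd.
rewrite frame_at0 -{2 3}[s.+1]addn1 frame_at /= add0n.
have -> : upd (frame v s [:: 0, b & l]) s b = frame v s [:: b, b & l].
  by rewrite -[X in upd _ X]addn0 frame_upd.
rewrite frame_upd //=.
rewrite frame_cons [frame v s (b :: l)]frame_cons.
exact: IH.
Qed.

Fixpoint popn s m k := if m is m'.+1 then Seq (pop s (m' + k)) (popn s m' k) else Skip.

Lemma exec_popn s l l' x v :
  exec (popn s (size l) (size l')) (x, frame v s (l ++ l')) (x, frame v s l').
Proof.
elim: l => [|a l IH] /=; first exact: ExecSkip.
by apply: ExecSeq; last exact: IH; rewrite -size_cat; apply: exec_pop.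
Qed.

Lemma exec_popn1 s l a x v :
  exec (popn s (size l) 1) (x, frame v s (l ++ [:: a])) (x, frame v s [:: a]).
Proof. exact: (@exec_popn s l [:: a]). Qed.

Notation rec_all gs := (forall i, i < size gs -> rec (nth (fun=> 0) gs i)).

Lemma all_lt_leq s s' rho : s <= s' -> all (fun i => i < s) rho -> all (fun i => i < s') rho.
Proof. by move=> h; apply: sub_all => i /leq_trans; apply. Qed.

Lemma all_iota_lt s n : all (fun i => i < s + n) (iota s n).
Proof. by apply/allP => i; rewrite mem_iota => /andP[]. Qed.

Lemma rec_comp f gs : rec f -> rec_all gs -> rec (fun e => f ([seq g e | g <- gs] ++ e)).
Proof.
move=> hf hgs rho s hs.
have [c1 h1] := exec_evals hgs hs.
have [c2 h2] : exists c, forall x v, exec c (x, frame v (s + size gs) [::])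
    (x, frame v (s + size gs) [:: f [seq v i | i <- iota s (size gs) ++ rho]]).
  by apply: hf; rewrite all_cat all_iota_lt (all_lt_leq (leq_addr _ _) hs).
exists (Seq c1 (Seq c2 (popn s (size gs) 1))) => x v.
apply: ExecSeq; first exact: h1.
set l := map _ gs; set w := frame v s l.
have szl : size l = size gs by rewrite size_map.
have := h2 x w; rewrite {1 2}/w -szl -!frame_cat map_cat map_frame_iota.
rewrite (map_frame _ _ hs) cats0 => h2'.
by apply: ExecSeq; [exact: h2' | exact: exec_popn1].
Qed.

Lemma rec_rename f (h : forall T, seq T -> seq T) :
  (forall T U (v : T -> U) r, map v (h _ r) = h _ (map v r)) ->
  (forall T (p : pred T) r, all p r -> all p (h _ r)) ->
  rec f -> rec (fun e => f (h _ e)).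
Proof.
move=> hmap hall hf rho s hs; have [c hc] := hf (h _ rho) s (hall _ _ _ hs).
by exists c => x v; have := hc x v; rewrite hmap.
Qed.

Lemma rec_weaken f : rec f -> rec (fun e => f (behead e)).
Proof.
apply: (rec_rename (h := @behead)) => [T U v [|]|T p [|a r]] //=.
by case/andP.
Qed.

(** Iterating a vector of registers yields bounded sums and the simulation of machines without
    coding tuples by numbers. The loop counter sits at [s] with the vector above it; each round
    evaluates the new vector on top and removes the old one from below. *)
Lemma rec_viter bs ss n h : size ss = size bs -> rec_all bs -> rec_all ss -> rec n -> rec h ->
  rec (fun e => h (iter (n e) (fun acc => [seq s (acc ++ e) | s <- ss]) [seq b e | b <- bs])).
Proof.
move=> sz hbs hss hn hh rho s hs; set m := size bs.
have [c1 h1] : exists c, forall x v, exec c (x, frame v s [::])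
    (x, frame v s [seq g [seq v i | i <- rho] | g <- n :: bs]).
  by apply: exec_evals hs => -[|i] //= hi; exact: hbs.
have [c2 h2] : exists c, forall x v, exec c (x, frame v (s.+1 + m) [::])
    (x, frame v (s.+1 + m) [seq g [seq v i | i <- iota s.+1 m ++ rho] | g <- ss]).
  apply: exec_evals => //; rewrite all_cat all_iota_lt /=.
  by apply: all_lt_leq hs; rewrite addSn leqW // leq_addr.
have [c3 h3] := hh (iota s.+1 m) (s.+1 + m) (all_iota_lt _ _).
exists (Seq c1 (Seq (While s (Seq (Dec s) (Seq c2 (popn s.+1 m m)))) (Seq c3 (popn s m.+1 1)))) => x v.
apply: ExecSeq; first exact: h1.
rewrite /=; set e := map v rho; pose F acc := [seq s0 (acc ++ e) | s0 <- ss].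
rewrite -/F; set k := n e; set acc0 := map _ bs.
have sz0 : size acc0 = m by rewrite size_map.
have szF i : size (iter i F acc0) = m.
  by case: i => [|i] //=; rewrite /F size_map sz.
apply: (@ExecSeq _ _ _ (x, frame v s (0 :: iter k F acc0))); last first.
  set l := 0 :: iter k F acc0.
  have szl : size l = m.+1 by rewrite /= szF.
  have := h3 x (frame v s l); set a := h _.
  move=> h3'; apply: (@ExecSeq _ _ _ (x, frame v s (l ++ [:: h (iter k F acc0)]))).
    have -> : h (iter k F acc0) = a.
      by congr h; under eq_map => i0 do rewrite /l frame_cons; rewrite -(szF k); exact/esym/map_frame_iota.
    have eqs : s.+1 + m = s + size l by rewrite szl addSnnS.
    by move: h3'; rewrite eqs -!frame_cat cats0.
  by have := exec_popn1 s l (h (iter k F acc0)) x v; rewrite szl.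
elim: (k) acc0 sz0 {szF} => [|j IH] acc sza.
  by apply: ExecWhile0; rewrite frame_at0.
rewrite iterSr; apply: (ExecWhileS _ _ (IH (F acc) _)); first by rewrite frame_at0.
  apply: ExecSeq; first exact: ExecDec.
  rewrite frame_at0 -[X in upd _ X]addn0 frame_upd //=.
  have := h2 x (frame v s (j :: acc)).
  have -> : [seq frame v s (j :: acc) i | i <- iota s.+1 m ++ rho] = acc ++ e.
    rewrite map_cat (map_frame _ _ hs) -sza; congr (_ ++ _).
    by under eq_map => i0 do rewrite frame_cons; exact: map_frame_iota.
  have -> : s.+1 + m = s + size (j :: acc) by rewrite /= sza addSnnS.
  rewrite -!frame_cat cats0.
  move=> h2'; apply: ExecSeq; first exact: h2'.
  rewrite cat_cons frame_cons -{1}sza [in frame v s (j :: F acc)]frame_cons.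
  have -> : m = size (F acc) by rewrite size_map sz.
  exact: exec_popn.
by rewrite size_map sz.
Qed.

(** Unbounded search. The least zero is given as [g e], and induction on the distance to it shows
    that the loop terminates. *)
Lemma rec_mu f g : rec f -> (forall e, f (g e :: e) = 0) ->
  (forall e m, m < g e -> f (m :: e) != 0) -> rec g.
Proof.
move=> hf hg0 hg1 rho s hs.
have hs' : all (fun i => i < s.+1) (s :: rho).
  by rewrite /= ltnSn; apply: all_lt_leq hs.
have [c hc] := hf (s :: rho) s.+1 hs'.
exists (Seq c (While s.+1 (Seq (clear s.+1) (Seq (Inc s) c)))) => x v.
set e := map v rho.
have hm m : exec c (x, frame v s [:: m]) (x, frame v s [:: m; f (m :: e)]).
  have := hc x (frame v s [:: m]).
  by rewrite /= map_frame // frame_at0 -!frame_cons.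
rewrite -frame_0; apply: ExecSeq; first exact: hm.
suff H k m : m + k = g e -> exec (While s.+1 (Seq (clear s.+1) (Seq (Inc s) c)))
    (x, frame v s [:: m; f (m :: e)]) (x, frame v s [:: g e]) by exact: (H (g e)).
elim: k m => [|k IH] m.
  rewrite addn0 => ->; rewrite hg0 (frame_rcons0 v s [:: g e]).
  by apply: ExecWhile0; rewrite -addn1 frame_at.
move=> hmk; have lt_m : m < g e by rewrite -hmk addnS ltnS leq_addr.
apply: (ExecWhileS _ _ (IH m.+1 _)); last by rewrite addSnnS.
  by rewrite -addn1 frame_at /=; apply/eqP/hg1.
apply: ExecSeq; first exact: exec_clear.
rewrite -addn1 frame_upd //= (frame_rcons0 v s [:: m]).
apply: ExecSeq; first exact: ExecInc.
by rewrite frame_at0 -[X in upd _ X]addn0 frame_upd //=.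
Qed.

End Commands.

(** * Closure properties of the recursive functions *)

Section Arithmetic.
Variables I O : finType.
Local Notation rec := (@rec I O).
Local Notation var i := (fun e : seq nat => nth 0 e i).

Lemma rec_app1 F g : rec (fun e => F (nth 0 e 0)) -> rec g -> rec (fun e => F (g e)).
Proof. by move=> hF hg; apply: (rec_comp (gs := [:: g]) hF) => -[]. Qed.

Lemma rec_app2 F g1 g2 : rec (fun e => F (nth 0 e 0) (nth 0 e 1)) ->
  rec g1 -> rec g2 -> rec (fun e => F (g1 e) (g2 e)).
Proof. by move=> hF h1 h2; apply: (rec_comp (gs := [:: g1; g2]) hF) => -[|[]]. Qed.

Lemma rec_app3 F g1 g2 g3 : rec (fun e => F (nth 0 e 0) (nth 0 e 1) (nth 0 e 2)) ->
  rec g1 -> rec g2 -> rec g3 -> rec (fun e => F (g1 e) (g2 e) (g3 e)).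
Proof. by move=> hF h1 h2 h3; apply: (rec_comp (gs := [:: g1; g2; g3]) hF) => -[|[|[]]]. Qed.

Lemma rec_iter (F : nat -> seq nat -> nat) n b :
  rec (fun e => F (nth 0 e 0) (behead e)) -> rec n -> rec b ->
  rec (fun e => iter (n e) (F^~ e) (b e)).
Proof.
move=> hF hn hb.
have := @rec_viter I O [:: b] [:: fun e => F (nth 0 e 0) (behead e)] n (var 0) erefl.
set f := (f in _ -> _ -> _ -> _ -> rec f) => H.
apply: (@rec_ext _ _ f); last by apply: H => //; [case | case | exact: rec_var].
move=> e; rewrite /f.
suff -> k : iter k (fun acc => [seq s (acc ++ e) | s <- [:: fun e => F (nth 0 e 0) (behead e)]])
    [:: b e] = [:: iter k (F^~ e) (b e)] by [].
by elim: k => //= k ->.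
Qed.

Lemma rec_const k : rec (fun=> k).
Proof. by elim: k => [|k IH]; [exact: rec_zero | exact: rec_succ]. Qed.

Lemma rec_var1 i : rec (fun e => nth 0 (behead e) i).
Proof. by apply: (@rec_ext _ _ _ _ _ (@rec_var I O i.+1)) => e; rewrite nth_behead. Qed.

Lemma rec_add f g : rec f -> rec g -> rec (fun e => f e + g e).
Proof.
apply: rec_app2; apply: (@rec_ext _ _ (fun e => iter (nth 0 e 1) S (nth 0 e 0))).
  by move=> e; elim: (nth 0 e 1) => [|k /= ->]; rewrite ?addn0 ?addnS.
by apply: (rec_iter (F := fun a _ => a.+1)); [apply: rec_succ|..]; exact: rec_var.
Qed.

Lemma rec_mul f g : rec f -> rec g -> rec (fun e => f e * g e).
Proof.
apply: rec_app2; apply: (@rec_ext _ _ (fun e => iter (nth 0 e 1) (fun a => nth 0 e 0 + a) 0)).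
  by move=> e; elim: (nth 0 e 1) => [|k /= ->]; rewrite ?muln0 ?mulnS.
apply: (rec_iter (F := fun a e => nth 0 e 0 + a)); last exact: rec_zero.
  apply: rec_add; last exact: rec_var.
  exact: rec_var1.
exact: rec_var.
Qed.

Lemma rec_exp f g : rec f -> rec g -> rec (fun e => f e ^ g e).
Proof.
apply: rec_app2; apply: (@rec_ext _ _ (fun e => iter (nth 0 e 1) (fun a => nth 0 e 0 * a) 1)).
  by move=> e; elim: (nth 0 e 1) => [|k /= ->]; rewrite ?expnS.
apply: (rec_iter (F := fun a e => nth 0 e 0 * a)); last exact: rec_const.
  apply: rec_mul; last exact: rec_var.
  exact: rec_var1.
exact: rec_var.
Qed.

Lemma rec_sum (F : nat -> seq nat -> nat) n :
  rec (fun e => F (nth 0 e 0) (behead e)) -> rec n ->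
  rec (fun e => \sum_(y < n e) F y e).
Proof.
move=> hF hn.
pose s1 (e : seq nat) := (nth 0 e 0).+1.
pose s2 e := nth 0 e 1 + F (nth 0 e 0) (behead (behead e)).
have h2 : rec s2.
  apply: rec_add; first exact: rec_var.
  (* The step function sees the index, the partial sum and the environment; [h] removes the partial
     sum, which [F] must not see. *)
  pose h T (e : seq T) := take 1 e ++ drop 2 e.
  apply: (@rec_ext _ _ (fun e => F (nth 0 (h _ e) 0) (behead (h _ e)))).
    by case=> [|a [|a' e]]; rewrite /h /= ?take0 ?drop0.
  apply: (rec_rename (h := h) (f := fun e => F (nth 0 e 0) (behead e))) => //.
    by move=> T U v r; rewrite /h map_cat map_take map_drop.
  by move=> T p [|a [|a' r]] //= /and3P[a0 _ ar]; rewrite /h /= ?take0 ?drop0 /= a0.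
have := @rec_viter I O [:: fun=> 0; fun=> 0] [:: s1; s2] n (var 1) erefl.
set f := (f in _ -> _ -> _ -> _ -> rec f) => H.
apply: (@rec_ext _ _ f); last first.
  apply: H => //; last exact: rec_var.
    by move=> [|[|]] // _; exact: rec_zero.
  by move=> [|[|]] // _; apply: rec_succ; exact: rec_var.
move=> e; rewrite /f.
suff -> k : iter k (fun acc => [seq s (acc ++ e) | s <- [:: s1; s2]]) [:: 0; 0] =
    [:: k; \sum_(y < k) F y e] by [].
elim: k => [|k /= ->]; first by rewrite big_ord0.
by rewrite big_ord_recr.
Qed.

(** The predecessor of [n] counts the positive [y < n], and the sign of [y] is the [y]-fold iterate
    of the constant 1 started at 0. *)
Lemma rec_pred f : rec f -> rec (fun e => (f e).-1).
Proof.
apply: (rec_app1 (F := predn)).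
apply: (@rec_ext _ _ (fun e => \sum_(y < nth 0 e 0) (iter y (fun=> 1) 0))).
  move=> e; case: (nth 0 e 0) => [|k]; first by rewrite big_ord0.
  rewrite big_ord_recl add0n /= (eq_bigr (fun=> 1)) //.
  by rewrite sum_nat_const card_ord muln1.
apply: (rec_sum (F := fun y _ => iter y (fun=> 1) 0)); last exact: rec_var.
apply: (rec_iter (F := fun _ _ => 1)); [exact: rec_const | exact: rec_var | exact: rec_zero].
Qed.

Lemma rec_sub f g : rec f -> rec g -> rec (fun e => f e - g e).
Proof.
apply: rec_app2; apply: (@rec_ext _ _ (fun e => iter (nth 0 e 1) predn (nth 0 e 0))).
  by move=> e; elim: (nth 0 e 1) => [|k /= ->]; rewrite ?subn0 ?subnS.
by apply: (rec_iter (F := fun a _ => a.-1)); [apply: rec_pred|..]; exact: rec_var.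
Qed.

Definition recb (b : seq nat -> bool) := rec (fun e => nat_of_bool (b e)).

Lemma rec_eq0 f : rec f -> recb (fun e => f e == 0).
Proof.
move=> hf; apply: (@rec_ext _ _ (fun e => 1 - f e)); first by move=> e; case: (f e).
by apply: rec_sub => //; exact: rec_const.
Qed.

Lemma recb_not b : recb b -> recb (fun e => ~~ b e).
Proof. by move=> hb; apply: (@rec_ext _ _ _ _ _ (rec_eq0 hb)) => e; case: (b e). Qed.

Lemma recb_and b c : recb b -> recb c -> recb (fun e => b e && c e).
Proof. by move=> hb hc; apply: (@rec_ext _ _ _ _ _ (rec_mul hb hc)) => e; rewrite mulnb. Qed.

Lemma recb_or b c : recb b -> recb c -> recb (fun e => b e || c e).
Proof.
move=> hb hc; apply: (@rec_ext _ _ _ _ _ (recb_not (recb_and (recb_not hb) (recb_not hc)))).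
by move=> e; rewrite negb_and !negbK.
Qed.

Lemma recb_leq f g : rec f -> rec g -> recb (fun e => f e <= g e).
Proof. by move=> hf hg; apply: rec_eq0; exact: rec_sub. Qed.

Lemma recb_ltn f g : rec f -> rec g -> recb (fun e => f e < g e).
Proof. by move=> hf hg; apply: recb_leq => //; exact: rec_succ. Qed.

Lemma recb_eq f g : rec f -> rec g -> recb (fun e => f e == g e).
Proof.
move=> hf hg; apply: (@rec_ext _ _ _ _ _ (recb_and (recb_leq hf hg) (recb_leq hg hf))).
by move=> e; rewrite eqn_leq.
Qed.

Lemma recb_const b : recb (fun=> b).
Proof. exact: rec_const. Qed.

Lemma rec_if b f g : recb b -> rec f -> rec g -> rec (fun e => if b e then f e else g e).
Proof.
move=> hb hf hg.
apply: (@rec_ext _ _ _ _ _ (rec_add (rec_mul hb hf) (rec_mul (recb_not hb) hg))).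
by move=> e; case: (b e); rewrite ?mul1n ?mul0n ?addn0.
Qed.

Lemma recb_exists (P : nat -> seq nat -> bool) n :
  recb (fun e => P (nth 0 e 0) (behead e)) -> rec n ->
  recb (fun e => [exists y : 'I_(n e), P y e]).
Proof.
move=> hP hn.
have h := recb_not (rec_eq0 (rec_sum (F := fun y e => P y e) hP hn)).
apply: (@rec_ext _ _ _ _ _ h) => e.
rewrite sum_nat_eq0 negb_forall; congr nat_of_bool.
by apply: eq_existsb => y; rewrite /= eqb0 negbK.
Qed.

Lemma recb_forall (P : nat -> seq nat -> bool) n :
  recb (fun e => P (nth 0 e 0) (behead e)) -> rec n ->
  recb (fun e => [forall y : 'I_(n e), P y e]).
Proof.
move=> hP hn; have h := recb_not (recb_exists (P := fun y e => ~~ P y e) (recb_not hP) hn).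
apply: (@rec_ext _ _ _ _ _ h) => e.
by rewrite negb_exists; congr nat_of_bool; apply: eq_forallb => y; rewrite negbK.
Qed.

(** The quotient is the number of [y < f e] with [y.+1 * g e <= f e]. *)
Lemma rec_divn f g : (forall e, 0 < g e) -> rec f -> rec g -> rec (fun e => f e %/ g e).
Proof.
move=> g_gt0 hf hg.
have h : rec (fun e => \sum_(y < f e) (y.+1 * g e <= f e)).
  apply: (rec_sum (F := fun y e => y.+1 * g e <= f e)) => //.
  apply: (recb_leq (f := fun e => (nth 0 e 0).+1 * g (behead e)) (g := fun e => f (behead e)));
    last exact: rec_weaken.
  by apply: rec_mul; [apply: rec_succ; exact: rec_var | exact: rec_weaken].
apply: (@rec_ext _ _ _ _ _ h) => e.
rewrite (eq_bigr (fun y : 'I__ => nat_of_bool (y < f e %/ g e))); last first.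
  by move=> y _; rewrite -leq_divRL.
have : f e %/ g e <= f e by exact: leq_div.
move: (f e %/ g e) => q /minn_idPr {2}<-.
elim: (f e) => [|k IH]; first by rewrite big_ord0 min0n.
rewrite big_ord_recr /= IH; case: (ltnP k q) => h'.
  by rewrite addn1 !(minn_idPl _) // ltnW.
by rewrite addn0 !(minn_idPr _) // leqW.
Qed.

Lemma rec_modn f g : (forall e, 0 < g e) -> rec f -> rec g -> rec (fun e => f e %% g e).
Proof.
move=> g_gt0 hf hg; apply: (@rec_ext _ _ (fun e => f e - f e %/ g e * g e)).
  by move=> e; rewrite {1}(divn_eq (f e) (g e)) addKn.
by apply: rec_sub => //; apply: rec_mul => //; exact: rec_divn.
Qed.

(** Every function on a finite range is recursive, so letter maps and local rules need no
    computability hypothesis. *)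
Lemma rec_table (t : nat -> nat) n f : (forall e, f e < n) -> rec f -> rec (fun e => t (f e)).
Proof.
move=> f_lt hf; have h : rec (fun e => if f e < n then t (f e) else 0).
  elim: n {f_lt} => [|n IH]; first exact: rec_zero.
  apply: (@rec_ext _ _ (fun e => if f e == n then t n else if f e < n then t (f e) else 0)).
    by move=> e; rewrite ltnS (leq_eqVlt (f e) n); case: (eqVneq (f e) n) => [->|_].
  by apply: rec_if => //; [apply: recb_eq => //|]; exact: rec_const.
by apply: (@rec_ext _ _ _ _ _ h) => e; rewrite f_lt.
Qed.

End Arithmetic.

(** * Turing machines *)

Section Compile.
Variables I O : finType.
Local Notation cmd := (cmd I O).
Local Notation skip := (@Skip I O).

(* A machine state is a continuation, the list of the commands still to be run;
   only the finitely many residuals of the main program occur. *)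
Fixpoint residuals (c : cmd) (k : seq cmd) : seq {classic (seq cmd)} :=
  (c :: k) ::
  match c with
  | Seq a b => residuals a (b :: k) ++ residuals b k
  | While _ a => residuals a (c :: k)
  | Scan b => flatten [seq residuals (b i) (c :: k) | i <- enum I]
  | _ => [::]
  end.

Fixpoint registers (c : cmd) : nat :=
  match c with
  | Skip | Put _ => 0
  | Inc r | Dec r => r.+1
  | Seq a b => maxn (registers a) (registers b)
  | While r a => maxn r.+1 (registers a)
  | Scan b => \max_(i : I) registers (b i)
  end.

Lemma residuals_hd c k : (c :: k : {classic (seq cmd)}) \in residuals c k.
Proof. by case: c => *; rewrite inE eqxx. Qed.

Variables (main : cmd).

Definition states : seq {classic (seq cmd)} := [::] :: residuals main [::].

Local Notation symbol := (tm_symbol I O unit).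
Local Notation R := (registers main).

Definition mark : symbol := Some (inr tt).

(** Tape 0 carries input and output, tape [r.+1] the counter [r], which grows by a move to the
    right. [Dec] does not move off the marked cell, in accordance with the predecessor of 0 being
    0. *)
Definition transition (k : seq cmd) (h : 'I_R.+1 -> symbol) :
    seq cmd * ('I_R.+1 -> symbol * tm_move) :=
  let stay := fun j => (h j, Stay) in
  match k with
  | [::] => (k, stay)
  | Skip :: k' => (k', stay)
  | Inc r :: k' => (k', fun j => (h j, if j == r.+1 :> nat then MoveRight else Stay))
  | Dec r :: k' => (k', fun j => (h j, if (j == r.+1 :> nat) && (h j != mark) then MoveLeft else Stay))
  | Seq a b :: k' => (a :: b :: k', stay)
  | While r a :: k' => (if h (inord r.+1) == mark then k' else a :: k, stay)
  | Scan b :: k' =>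
      if h ord0 is Some (inl (inl i))
      then (b i :: k, fun j => (h j, if j == ord0 then MoveRight else Stay))
      else (k', stay)
  | Put o :: k' => (k', fun j => (if j == ord0 then Some (inl (inr o)) else h j, Stay))
  end.

Definition state0 : seq_sub states := SeqSub (mem_head _ _).

(* None is the initial state, in which the origins of the counters are marked. *)
Definition compiled : turing_machine I O :=
  @TuringMachine I O (option (seq_sub states)) unit R None
    (fun q => if q is Some k then nilp (ssval k) else false)
    (fun q h =>
       if q is Some k then
         let: (k', a) := transition (ssval k) h in (Some (insubd state0 k'), a)
       else (Some (insubd state0 [:: main]),
             fun j => (if j == ord0 then h j else mark, Stay))).

(** Comparing by [nth] with the blank as default ignores trailing blanks and makes the end of the
    input visible as a blank. *)
Definition reads (t : tm_tape symbol) (x : seq I + O) :=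
  match x with
  | inl w => forall i, nth None (tape_head t :: tape_right t) i =
                       nth None [seq Some (inl (inl a)) | a <- w] i
  | inr o => tape_head t = Some (inl (inr o))
  end.

(* A counter is the distance from the head to the marked cell. *)
Definition counts (t : tm_tape symbol) n :=
  (forall i, nth None (tape_head t :: tape_left t) i = if i == n then mark else None) /\
  (forall i, nth None (tape_right t) i = None).

Definition config_rel (k : seq cmd) (s : (seq I + O) * (nat -> nat))
    (c : tm_state compiled * ('I_R.+1 -> tm_tape symbol)) :=
  [/\ exists2 q, c.1 = Some q & ssval q = k, reads (c.2 ord0) s.1 &
      forall j : 'I_R.+1, j != ord0 -> counts (c.2 j) (s.2 j.-1)].

Lemma counts_mark t n : counts t n -> (tape_head t == mark) = (n == 0).
Proof. by case=> /(_ 0) /= -> _; rewrite eq_sym; case: n. Qed.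

Lemma counts_right t n : counts t n -> counts (tape_move None MoveRight t) n.+1.
Proof.
case: t => l h r [h1 h2]; split=> [[|i]|i] /=.
- by rewrite -nth0 h2.
- exact: h1.
- by rewrite nth_behead h2.
Qed.

Lemma counts_left t n : counts t n.+1 -> counts (tape_move None MoveLeft t) n.
Proof.
case: t => l h r [h1 h2]; split=> [[|i]|[|i]] /=.
- by rewrite -nth0; exact: (h1 1).
- by rewrite nth_behead; exact: (h1 i.+2).
- exact: (h1 0).
- exact: h2.
Qed.

Lemma reads_right t i w : reads t (inl (i :: w)) -> reads (tape_move None MoveRight t) (inl w).
Proof.
case: t => l h r /= h1 [|j] /=; first by rewrite -nth0; exact: (h1 1).
by rewrite nth_behead; exact: (h1 j.+2).
Qed.

Lemma tape_write_head (t : tm_tape symbol) : tape_write (tape_head t) t = t.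
Proof. by case: t. Qed.

Local Arguments tape_move : simpl never.

Lemma tape_stay (t : tm_tape symbol) : tape_move None Stay t = t.
Proof. by case: t. Qed.

Lemma step_next k k' s s' c : config_rel k s c -> k <> [::] -> k' \in states ->
  (transition k [ffun j => tape_head (c.2 j)]).1 = k' ->
  (let a := (transition k [ffun j => tape_head (c.2 j)]).2 in
   let t j := tape_move None (a j).2 (tape_write (a j).1 (c.2 j)) in
   reads (t ord0) s'.1 /\ forall j : 'I_R.+1, j != ord0 -> counts (t j) (s'.2 j.-1)) ->
  config_rel k' s' (tm_step c).
Proof.
case: c => [_ t] [[q /= -> qk] _ _] k0 hk' hk.
rewrite qk /=; have -> : nilp k = false by case: (k) k0.
case: transition hk => k1 a /= -> [h1 h2]; split=> //=.
by exists (insubd state0 k') => //; rewrite -[ssval _]/(val _) val_insubd hk'.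
Qed.

Lemma transition_scan0 b k h : h ord0 = None -> transition (Scan b :: k) h = (k, fun j => (h j, Stay)).
Proof. by move=> /= ->. Qed.

Lemma transition_scanS b k h i : h ord0 = Some (inl (inl i)) -> transition (Scan b :: k) h =
  (b i :: Scan b :: k, fun j => (h j, if j == ord0 then MoveRight else Stay)).
Proof. by move=> /= ->. Qed.

(** Induction on the execution. The continuation [k] is arbitrary because subcommands run under
    longer continuations; the inclusion of the residuals ensures that these are states of the
    machine. *)
Lemma exec_sim c s s' : exec c s s' -> forall k cfg,
  {subset residuals c k <= states} -> (k : {classic (seq cmd)}) \in states ->
  registers c <= R -> config_rel (c :: k) s cfg ->
  exists n, config_rel k s' (iter n (@tm_step _ _ compiled) cfg).
Proof.
elim=> {c s s'}.
- move=> s k cfg _ hk _ hrel; exists 1; apply: (step_next hrel) => //=.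
  by case: hrel => _ h1 h2; split=> [|j j0]; rewrite ffunE tape_write_head ?tape_stay //; exact: h2.
- move=> r x v k cfg _ hk hr hrel; exists 1; apply: (step_next hrel) => //=.
  case: hrel => _ h1 h2; split=> [|j j0]; rewrite ffunE tape_write_head ?tape_stay //.
  have := h2 j j0; rewrite /upd /=; case: eqP => [jr|jr].
    by rewrite jr eqxx /=; exact: counts_right.
  rewrite tape_stay; case: eqP => // jr'; case: jr; rewrite -jr' prednK //.
  by rewrite lt0n; apply: contra_neq j0 => j0; exact: val_inj.
- move=> r x v k cfg _ hk hr hrel; exists 1; apply: (step_next hrel) => //=.
  case: hrel => _ h1 h2; split=> [|j j0]; rewrite !ffunE tape_write_head ?tape_stay //.
  have := h2 j j0; rewrite /upd /=; case: eqP => [jr|jr] /=; last first.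
    rewrite tape_stay; case: eqP => // jr'; case: jr; rewrite -jr' prednK //.
    by rewrite lt0n; apply: contra_neq j0 => j0; exact: val_inj.
  rewrite jr eqxx /= => hc; rewrite (counts_mark hc).
  by case: (v r) hc => [|n] hc /=; [rewrite tape_stay | exact: counts_left].
- move=> c d s1 s2 s3 _ IHc _ IHd k cfg hsub hk.
  rewrite /= geq_max => /andP[hc hd] hrel.
  have hdk : (d :: k : {classic (seq cmd)}) \in states.
    by apply: hsub; rewrite /= inE mem_cat residuals_hd !orbT.
  have sub1 : {subset residuals c (d :: k) <= states}.
    by move=> z hz; apply: hsub; rewrite /= inE mem_cat hz orbT.
  have sub2 : {subset residuals d k <= states}.
    by move=> z hz; apply: hsub; rewrite /= inE mem_cat hz !orbT.
  have rel1 : config_rel (c :: d :: k) s1 (tm_step cfg).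
    apply: (step_next hrel) => //=; first exact/sub1/residuals_hd.
    by case: hrel => _ h1 h2; split=> [|j j0]; rewrite ffunE tape_write_head ?tape_stay //; exact: h2.
  have [n1 rel2] := IHc _ _ sub1 hdk hc rel1.
  have [n2 rel3] := IHd _ _ sub2 hk hd rel2.
  by exists (n2 + (n1 + 1)); rewrite !iterD.
- move=> r c x v vr k cfg _ hk; rewrite /= geq_max => /andP[hr _] hrel; exists 1.
  have j0 : (inord r.+1 : 'I_R.+1) != ord0.
    by apply/eqP => /(congr1 val) /=; rewrite inordK.
  have hz : (tape_head (cfg.2 (inord r.+1)) == mark) = true.
    by case: (hrel) => _ _ /(_ _ j0) /counts_mark ->; rewrite inordK //= vr eqxx.
  apply: (step_next hrel) => //=; first by rewrite ffunE hz.
  by case: hrel => _ h1 h2; split=> [|j j1]; rewrite ffunE tape_write_head ?tape_stay //; exact: h2.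
- move=> r c x v s2 s3 vr _ IHc _ IHw k cfg hsub hk hr' hrel.
  move: (hr'); rewrite /= geq_max => /andP[hr hc].
  have j0 : (inord r.+1 : 'I_R.+1) != ord0.
    by apply/eqP => /(congr1 val) /=; rewrite inordK.
  have hz : (tape_head (cfg.2 (inord r.+1)) == mark) = false.
    by case: (hrel) => _ _ /(_ _ j0) /counts_mark ->; rewrite inordK //=; apply/eqP.
  have sub1 : {subset residuals c (While r c :: k) <= states}.
    by move=> z hz'; apply: hsub; rewrite /= inE hz' orbT.
  have rel1 : config_rel (c :: While r c :: k) (x, v) (tm_step cfg).
    apply: (step_next hrel) => //=; [exact/sub1/residuals_hd | by rewrite ffunE hz |].
    by case: hrel => _ h1 h2; split=> [|j j1]; rewrite ffunE tape_write_head ?tape_stay //; exact: h2.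
  have [|n1 rel2] := IHc _ _ sub1 _ hc rel1; first exact/hsub/residuals_hd.
  have [n2 rel3] := IHw _ _ hsub hk hr' rel2.
  by exists (n2 + (n1 + 1)); rewrite !iterD.
- move=> b v k cfg _ hk _ hrel; exists 1.
  have hz : tape_head (cfg.2 ord0) = None by case: (hrel) => _ /(_ 0).
  have /(transition_scan0 b k) hn : [ffun j => tape_head (cfg.2 j)] ord0 = None by rewrite ffunE.
  apply: (step_next hrel) => //; rewrite hn //=.
  case: hrel => _ h1 h2; split=> [|j j1]; rewrite ffunE; first exact: h1.
  by rewrite tape_write_head tape_stay; exact: h2.
- move=> b i w v s2 s3 _ IHb _ IHs k cfg hsub hk hr' hrel.
  have hz : tape_head (cfg.2 ord0) = Some (inl (inl i)) by case: (hrel) => _ /(_ 0).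
  have sub1 : {subset residuals (b i) (Scan b :: k) <= states}.
    move=> z hz'; apply: hsub; rewrite /= inE; apply/orP; right.
    by apply/flattenP; exists (residuals (b i) (Scan b :: k)) => //; apply: map_f; rewrite mem_enum.
  have rel1 : config_rel (b i :: Scan b :: k) (inl w, v) (tm_step cfg).
    have /(transition_scanS b k) hn : [ffun j => tape_head (cfg.2 j)] ord0 = Some (inl (inl i)).
      by rewrite ffunE.
    apply: (step_next hrel) => //; [exact/sub1/residuals_hd | by rewrite hn | rewrite hn].
    case: hrel => _ h1 h2; split=> [|j j1] /=.
      by have := reads_right h1; case: (cfg.2 ord0).
    by rewrite ffunE tape_write_head (negbTE j1) tape_stay; exact: h2.
  have hb : registers (b i) <= R.
    by apply: leq_trans hr' => /=; exact: (leq_bigmax i).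
  have [|n1 rel2] := IHb _ _ sub1 _ hb rel1; first exact/hsub/residuals_hd.
  have [n2 rel3] := IHs _ _ hsub hk hr' rel2.
  by exists (n2 + (n1 + 1)); rewrite !iterD.
- move=> o x v k cfg _ hk _ hrel; exists 1; apply: (step_next hrel) => //=.
  case: hrel => _ h1 h2; split=> [|j j0]; rewrite ?eqxx //.
  by rewrite (negbTE j0) ffunE tape_write_head tape_stay; exact: h2.
Qed.

Lemma compiled_halts w o v : exec main (inl w, fun=> 0) (inr o, v) -> tm_halts_with compiled w o.
Proof.
move=> hex.
have rel0 : config_rel [:: main] (inl w, fun=> 0) (tm_step (tm_init compiled w)).
  split=> /=.
  - exists (insubd state0 [:: main]) => //.
    by rewrite -[ssval _]/(val _) val_insubd inE residuals_hd orbT.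
  - by case: (w) => [|a w1] [|i]; rewrite /= ?ffunE ?nth_nil.
  - move=> j j0; rewrite (negbTE j0) /=; split=> [[|i]|i] //=; rewrite nth_nil //.
have sub : {subset residuals main [::] <= states} by move=> z; rewrite inE => ->; rewrite orbT.
have [n rel1] := exec_sim hex sub (mem_head _ _) (leqnn _) rel0.
case: rel1 => -[q hq qk] h1 _; exists (n + 1); rewrite iterD /= hq qk; split=> //.
Qed.

End Compile.


(** * From recursive functions to Turing machines *)

Section RecMachine.
Variables I O : finType.

(** A countdown: each letter is written tentatively and overwritten by a later one if the register
    is not yet zero. The final [clear] makes the loop run at most once, so that it acts as a
    conditional. *)
Fixpoint put_letter (l : seq O) r : cmd I O :=
  if l is o :: l' then Seq (@Put I O o) (While r (Seq (Dec I O r) (Seq (put_letter l' r) (clear I O r))))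
  else Skip I O.

Lemma exec_put_letter l r x v o0 : v r < size l ->
  exists v', exec (put_letter l r) (x, v) (inr (nth o0 l (v r)), v').
Proof.
elim: l x v => [|o l IH] x v //= hr.
case hv: (v r) hr => [|m] hm.
  exists v; apply: ExecSeq; [exact: ExecPut | exact: ExecWhile0].
have eqm : upd v r m r = m by rewrite /upd eqxx.
have := IH (inr o) (upd v r m); rewrite eqm => /(_ hm) [v' hex].
exists (upd v' r 0); apply: ExecSeq; first exact: ExecPut.
apply: ExecWhileS; first by rewrite hv.
  apply: ExecSeq; first exact: ExecDec.
  rewrite hv /=; apply: ExecSeq; [exact: hex | exact: exec_clear].
  by apply: ExecWhile0; rewrite /upd eqxx.
Qed.

Definition word_code (w : seq I) : nat := foldl (fun a i => a * #|I|.+1 + (enum_rank i).+1) 0 w.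

(** The program folds the input into its code in register 0, computes [f] in register 1 and writes
    the letter of that rank. *)
Lemma rec_machine (f : nat -> nat) (out : seq I -> O) :
  rec I O (fun e => f (nth 0 e 0)) -> (forall w, f (word_code w) = enum_rank (out w)) ->
  exists M : turing_machine I O, forall w, tm_halts_with M w (out w).
Proof.
move=> hf hout.
have [cf hcf] := hf [:: 0] 1 isT.
have hb (i : I) : exists c : cmd I O, forall x a, exec c (x, frame (fun=> 0) 0 [:: a])
    (x, frame (fun=> 0) 0 [:: a * #|I|.+1 + (enum_rank i).+1]).
  have hi : rec I O (fun e => nth 0 e 0 * #|I|.+1 + (enum_rank i).+1).
    by apply: rec_add; [apply: rec_mul; [exact: rec_var|]|]; exact: rec_const.
  have [c hc] := hi [:: 0] 1 isT.
  exists (Seq c (popn I O 0 1 1)) => x a.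
  have := hc x (frame (fun=> 0) 0 [:: a]); rewrite -!frame_cons /= => hc'.
  by apply: ExecSeq; [exact: hc' | exact: (exec_popn1 0 [:: a])].
have [cb hcb] := choice hb.
exists (compiled (Seq (Scan cb) (Seq cf (put_letter (enum O) 1)))) => w.
have hscan u a : exec (Scan cb) (inl u, frame (fun=> 0) 0 [:: a])
    (inl [::], frame (fun=> 0) 0 [:: foldl (fun a i => a * #|I|.+1 + (enum_rank i).+1) a u]).
  elim: u a => [|i u IH] a; first exact: ExecScan0.
  by apply: ExecScanS (hcb _ _ _) _ => //; exact: IH.
have := hcf (inl [::]) (frame (fun=> 0) 0 [:: word_code w]).
rewrite -!frame_cons /= hout => hf'.
have [|v' hput] := @exec_put_letter (enum O) 1 (inl [::])
    (frame (fun=> 0) 0 [:: word_code w; enum_rank (out w) : nat]) (out w).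
  by rewrite /frame /= -cardE ltn_ord.
apply: (@compiled_halts _ _ _ w (out w) v').
apply: ExecSeq.
  have := hscan w 0; rewrite frame_0.
  have -> : frame (fun=> 0) 0 [::] = (fun=> 0) by apply: funext => i; rewrite /frame /= nth_nil.
  exact.
apply: ExecSeq; first exact: hf'.
by move: hput; rewrite /= nth_enum_rank.
Qed.
End RecMachine.

(** * Words as numbers and simulation of Turing machines *)

Section WordNumbers.
Variable I : finType.
Local Notation B := #|I|.+1.

(* A number stands for the word of its nonzero digits in base B; padding with
   zeros is harmless, so words are concatenated by v * B ^ w + w. *)
Definition letter (d : nat) : seq I := if d is d'.+1 then take 1 (drop d' (enum I)) else [::].

Fixpoint word_fuel f n : seq I :=
  if f is f'.+1 then word_fuel f' (n %/ B) ++ letter (n %% B) else [::].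

Definition word n := word_fuel n n.

Hypothesis I_gt0 : 0 < #|I|.

(** As [B] is at least 2, division by [B] decreases every positive number, so [n] is enough fuel;
    once 0 is reached only empty words are added. *)
Lemma word_fuelE f n : n <= f -> word_fuel f n = word n.
Proof.
rewrite /word; elim: n {-2}n (leqnn n) f => [|m IH] n.
  rewrite leqn0 => /eqP-> f _ /=; elim: f => //= f IHf.
  by rewrite ?div0n ?mod0n /= cats0.
case: n => [_ f _|n hn [|f] //= hf]; first by apply: IH.
have h : n.+1 %/ B <= n by rewrite -ltnS ltn_Pdiv.
congr (_ ++ _); rewrite !ltnS in hn hf.
by rewrite !(IH (n.+1 %/ B)) ?(leq_trans h).
Qed.

Lemma word_rcons a d : d < B -> word (a * B + d) = word a ++ letter d.
Proof.
move=> hd; rewrite -(@word_fuelE (a * B + d).+1) //=.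
rewrite divnMDl // divn_small // addn0 modnMDl modn_small // word_fuelE //.
exact: leq_trans (leq_pmulr _ _) (leq_addr _ _).
Qed.

Lemma word_cat_exp v m w : w < B ^ m -> word (v * B ^ m + w) = word v ++ word w.
Proof.
elim: m w => [|m IH] w; first by rewrite expn0 ltnS leqn0 muln1 => /eqP->; rewrite addn0 cats0.
rewrite expnSr {2 3}(divn_eq w B) => hw.
have hm : w %% B < B by exact: ltn_pmod.
rewrite mulnA addnA -mulnDl !word_rcons // IH ?catA //.
by rewrite ltn_divLR.
Qed.

(** Since [w < B ^ w], a shift by [w] places makes room for all digits of [w] without computing its
    length. *)
Definition catw v w := v * B ^ w + w.

Lemma word_catw v w : word (catw v w) = word v ++ word w.
Proof. by rewrite word_cat_exp // ltn_expl. Qed.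

Lemma letterE (i : I) : letter (enum_rank i).+1 = [:: i].
Proof.
rewrite /= (drop_nth i) ?nth_enum_rank /= ?take0 //.
by rewrite -cardE.
Qed.

Lemma word_codeK w : word (word_code w) = w.
Proof.
elim/last_ind: w => [|w i IH] //.
by rewrite /word_code foldl_rcons word_rcons ?ltnS ?ltn_ord // letterE -/(word_code w) IH cats1.
Qed.

End WordNumbers.

(** * Bounded halting as an arithmetic predicate *)

Section Simulation.
Variables (I0 O0 : finType).
Local Notation rec := (rec I0 O0).
Local Notation recb := (recb I0 O0).
Local Notation var i := (fun e : seq nat => nth 0 e i).

Lemma rec_bigsum (T : Type) (l : seq T) (f : T -> seq nat -> nat) :
  (forall t, rec (f t)) -> rec (fun e => \sum_(t <- l) f t e).
Proof.
move=> hf; elim: l => [|t l IH].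
  by apply: (rec_ext _ (@rec_zero _ _)) => e; rewrite big_nil.
by apply: (rec_ext _ (rec_add (hf t) IH)) => e; rewrite big_cons.
Qed.

Lemma recb_all (T : Type) (l : seq T) (b : T -> seq nat -> bool) :
  (forall t, recb (b t)) -> recb (fun e => all (fun t => b t e) l).
Proof. by move=> hb; elim: l => [|t l IH]; [exact: recb_const | exact: recb_and]. Qed.

Lemma rec_select (T : finType) (b : T -> seq nat -> bool) (f : T -> seq nat -> nat) :
  (forall t, recb (b t)) -> (forall t, rec (f t)) ->
  rec (fun e => \sum_(t <- enum T) b t e * f t e).
Proof.
move=> hb hf; apply: (@rec_bigsum _ _ (fun t e => b t e * f t e)) => t.
by apply: rec_mul; [exact: hb | exact: hf].
Qed.

Lemma select_eq (T : finType) (b : pred T) (f : T -> nat) t :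
  (forall t', b t' = (t' == t)) -> \sum_(t' <- enum T) b t' * f t' = f t.
Proof.
move=> hb; rewrite big_enum /= (bigD1 t) //= hb eqxx mul1n big1 ?addn0 // => t' ht'.
by rewrite hb (negbTE ht').
Qed.

Variables (I O : finType) (M : turing_machine I O).
Local Notation symbol := (tm_symbol I O (tm_work M)).
Local Notation K := #|{: I + O + tm_work M}|.+1.
Local Notation k := (tm_extra M).+1.

(* Tape contents are numbers in base K with the blank as the digit 0, so that
   trailing blanks are immaterial. *)
Definition digit_of (a : symbol) : nat := if a is Some x then (enum_rank x).+1 else 0.

Definition num (l : seq symbol) (n : nat) := foldr (fun a n => digit_of a + K * n) n l.

Lemma digit_of_lt a : digit_of a < K.
Proof. by case: a => //= x; rewrite ltnS ltn_ord. Qed.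

Lemma digit_of_inj : injective digit_of.
Proof. by move=> [x|] [y|] //= [] /val_inj /enum_rank_inj ->. Qed.

Lemma num_cat l l' n : num (l ++ l') n = num l (num l' n).
Proof. exact: foldr_cat. Qed.

Lemma num_mod l : num l 0 %% K = digit_of (head None l).
Proof.
case: l => [|a l] /=; first by rewrite mod0n.
by rewrite mulnC addnC modnMDl modn_small ?digit_of_lt.
Qed.

Lemma num_div l : num l 0 %/ K = num (behead l) 0.
Proof.
case: l => [|a l] /=; first by rewrite div0n.
by rewrite mulnC addnC divnMDl // divn_small ?addn0 ?digit_of_lt.
Qed.

Local Notation config := (tm_state M * ('I_k -> tm_tape symbol))%type.

(** Each half tape has the cell nearest to the head as its lowest digit, the scanned cell belonging
    to the right half. Head moves are then multiplications and divisions by [K]. *)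
Definition lnum (c : config) j := num (tape_left (c.2 j)) 0.
Definition rnum (c : config) j := num (tape_head (c.2 j) :: tape_right (c.2 j)) 0.
Definition vec (c : config) : seq nat :=
  (enum_rank c.1 : nat) :: [seq lnum c j | j <- enum 'I_k] ++ [seq rnum c j | j <- enum 'I_k].

Definition vl (j : 'I_k) (e : seq nat) := nth 0 e j.+1.
Definition vr (j : 'I_k) (e : seq nat) := nth 0 e (k + j).+1.

Lemma vl_vec c j e : vl j (vec c ++ e) = lnum c j.
Proof.
rewrite /vl /= nth_cat size_cat !(size_map _ (enum 'I_k)) size_enum_ord ltn_addr // nth_cat (size_map _ (enum 'I_k)) size_enum_ord ltn_ord.
by rewrite (nth_map j) ?size_enum_ord // nth_ord_enum.
Qed.

Lemma vr_vec c j e : vr j (vec c ++ e) = rnum c j.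
Proof.
rewrite /vr /= nth_cat size_cat !(size_map _ (enum 'I_k)) size_enum_ord ltn_add2l ltn_ord.
rewrite nth_cat (size_map _ (enum 'I_k)) size_enum_ord ltnNge leq_addr /= addKn.
by rewrite (nth_map j) ?size_enum_ord // nth_ord_enum.
Qed.

Local Notation key := (tm_state M * {ffun 'I_k -> symbol})%type.

Definition at_key (t : key) (e : seq nat) :=
  (nth 0 e 0 == enum_rank t.1) && all (fun j => vr j e %% K == digit_of (t.2 j)) (enum 'I_k).

(** Lookup in the finite transition table, written as a sum of which only the term of the current
    key survives. *)
Definition sel (f : key -> seq nat -> nat) (e : seq nat) :=
  \sum_(t <- enum [the finType of key]) at_key t e * f t e.

Definition halted (t : key) := tm_halting t.1.
Definition moved (t : key) j := ((tm_trans t.1 t.2).2 j).2.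
Definition written (t : key) j := digit_of ((tm_trans t.1 t.2).2 j).1.

Definition new_state (t : key) (e : seq nat) : nat :=
  if halted t then nth 0 e 0 else enum_rank (tm_trans t.1 t.2).1.

Definition new_left j (t : key) (e : seq nat) : nat :=
  if halted t then vl j e else
  match moved t j with
  | MoveLeft => vl j e %/ K
  | Stay => vl j e
  | MoveRight => written t j + K * vl j e
  end.

Definition new_right j (t : key) (e : seq nat) : nat :=
  if halted t then vr j e else
  match moved t j with
  | MoveLeft => vl j e %% K + K * (written t j + K * (vr j e %/ K))
  | Stay => written t j + K * (vr j e %/ K)
  | MoveRight => vr j e %/ K
  end.

Definition step_fns : seq (seq nat -> nat) :=
  sel new_state :: [seq sel (new_left j) | j <- enum 'I_k] ++ [seq sel (new_right j) | j <- enum 'I_k].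

Lemma selE f c e : sel f (vec c ++ e) =
  f (c.1, [ffun j => tape_head (c.2 j)]) (vec c ++ e).
Proof.
rewrite /sel; apply: (select_eq (b := fun t => at_key t (vec c ++ e))
    (fun t => f t (vec c ++ e))) => -[q h].
rewrite /at_key /= xpair_eqE; congr andb.
  by rewrite eq_sym (inj_eq val_inj) (inj_eq enum_rank_inj).
apply/allP/eqP => [H|-> j _]; last by rewrite vr_vec num_mod ffunE.
apply/ffunP => j; have := H j (mem_enum _ _); rewrite vr_vec num_mod /= => /eqP/digit_of_inj <-.
by rewrite ffunE.
Qed.

Lemma step_vec c e : [seq s (vec c ++ e) | s <- step_fns] = vec (tm_step c).
Proof.
rewrite /step_fns map_cons map_cat -!(map_comp _ _ (enum 'I_k)) [RHS]/vec.
congr (_ :: _ ++ _).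
- rewrite selE /new_state /halted; case: c => q t /=; case: ifP => //= _.
  by case: tm_trans.
- apply: eq_map => j; rewrite [LHS]selE /new_left /halted /moved /written vl_vec.
  case: c => q t /=; case: ifP => //= _; case: tm_trans => q' a /=.
  by rewrite /lnum /=; case: (a j).2; case: (t j) => l h r //=; rewrite num_div.
- apply: eq_map => j; rewrite [LHS]selE /new_right /halted /moved /written vl_vec vr_vec.
  case: c => q t /=; case: ifP => //= _; case: tm_trans => q' a /=.
  rewrite /rnum num_div /lnum num_mod /=; case: (a j).2; case: (t j) => l h r //=.
  by case: r => [|x r] //=; rewrite muln0.
Qed.

Lemma rec_vl j : rec (vl j). Proof. exact: rec_var. Qed.
Lemma rec_vr j : rec (vr j). Proof. exact: rec_var. Qed.

Lemma rec_sel f : (forall t, rec (f t)) -> rec (sel f).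
Proof.
apply: rec_select => t; apply: recb_and.
  by apply: recb_eq; [exact: rec_var | exact: rec_const].
apply: recb_all => j; apply: recb_eq; last exact: rec_const.
by apply: rec_modn => //; [exact: rec_vr | exact: rec_const].
Qed.

Lemma rec_new_state t : rec (new_state t).
Proof. by rewrite /new_state; case: halted; [exact: rec_var | exact: rec_const]. Qed.

Lemma rec_new_left j t : rec (new_left j t).
Proof.
rewrite /new_left; case: halted; first exact: rec_vl.
case: moved; first by apply: rec_divn => //; [exact: rec_vl | exact: rec_const].
  exact: rec_vl.
by apply: rec_add; last (apply: rec_mul; last exact: rec_vl); exact: rec_const.
Qed.

Lemma rec_new_right j t : rec (new_right j t).
Proof.
have hdiv : rec (fun e => vr j e %/ K).
  by apply: rec_divn => //; [exact: rec_vr | exact: rec_const].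
have hw : rec (fun e => written t j + K * (vr j e %/ K)).
  by apply: rec_add; last (apply: rec_mul => //); exact: rec_const.
rewrite /new_right; case: halted; first exact: rec_vr.
case: moved => //; apply: rec_add; first by apply: rec_modn => //; [exact: rec_vl | exact: rec_const].
by apply: rec_mul => //; exact: rec_const.
Qed.

Lemma rec_step_fns i : i < size step_fns -> rec (nth (fun=> 0) step_fns i).
Proof.
case: i => [_|i]; first exact/rec_sel/rec_new_state.
rewrite /= size_cat !(size_map _ (enum 'I_k)) size_enum_ord ltnS => hi.
rewrite nth_cat (size_map _ (enum 'I_k)) size_enum_ord; case: ltnP => h.
  rewrite (nth_map ord0) ?size_enum_ord //; exact/rec_sel/rec_new_left.
rewrite (nth_map ord0) ?size_enum_ord; first exact/rec_sel/rec_new_right.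
by rewrite ltn_subLR.
Qed.

Local Notation B := #|I|.+1.

Definition input_digit d := num [seq tm_input M i | i <- letter I d] 0.

(* The word is read from its last letter on. *)
Definition input_num n :=
  nth 0 (iter n (fun acc => [:: nth 0 acc 0 %/ B;
    let d := nth 0 acc 0 %% B in
    if d == 0 then nth 0 acc 1 else input_digit d + K * nth 0 acc 1]) [:: n; 0]) 1.

Lemma num_letter d h : d < B ->
  num [seq tm_input M i | i <- letter I d] h = if d == 0 then h else input_digit d + K * h.
Proof.
case: d => // d hd; rewrite /input_digit /=.
have : 0 < size (drop d (enum I)) by rewrite size_drop -cardE subn_gt0.
by case: drop => //= i l _; rewrite take0 /= muln0 addn0.
Qed.

Lemma input_numE n : input_num n = num [seq tm_input M i | i <- word I n] 0.
Proof.
rewrite /input_num /word; set F := fun acc => _.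
suff H f v h : nth 0 (iter f F [:: v; h]) 1 = num [seq tm_input M i | i <- word_fuel I f v] h by exact: H.
elim: f v h => // f IH v h.
rewrite iterSr {2}/F /= IH map_cat num_cat; congr num.
by rewrite num_letter // ltn_pmod.
Qed.

Lemma rec_input_num f : rec f -> rec (fun e => input_num (f e)).
Proof.
apply: rec_app1.
pose ss := [:: fun e : seq nat => nth 0 e 0 %/ B;
  fun e => if nth 0 e 0 %% B == 0 then nth 0 e 1 else input_digit (nth 0 e 0 %% B) + K * nth 0 e 1].
have H := @rec_viter I0 O0 [:: var 0; fun=> 0] ss (var 0) (var 1) erefl.
suff Hs : forall i, i < size ss -> rec (nth (fun=> 0) ss i).
  apply: (rec_ext _ (H _ Hs (rec_var _ _ _) (rec_var _ _ _))).
    move=> e; rewrite /input_num; congr nth; rewrite [map _ _]/=.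
    set F1 := fun _ => _; set F2 := fun _ => _.
    suff H' m a b : iter m F1 [:: a; b] = iter m F2 [:: a; b] by exact: H'.
    by elim: m a b => // m IH a b; rewrite !iterSr IH.
  by case=> [|[|]] // _; [exact: rec_var | exact: rec_zero].
have hmod : rec (fun e => nth 0 e 0 %% B).
  by apply: rec_modn => //; [exact: rec_var | exact: rec_const].
case=> [|[|]] // _.
  by apply: rec_divn => //; [exact: rec_var | exact: rec_const].
apply: rec_if; [by apply: rec_eq0 | exact: rec_var |].
apply: rec_add; last by apply: rec_mul; [exact: rec_const | exact: rec_var].
by apply: (@rec_table _ _ input_digit B) => // e; exact: ltn_pmod.
Qed.

Definition init_fns : seq (seq nat -> nat) :=
  (fun=> enum_rank (tm_start M) : nat) :: [seq (fun=> 0) | j <- enum 'I_k] ++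
  [seq if j == ord0 then (fun e => input_num (nth 0 e 0)) else (fun=> 0) | j <- enum 'I_k].

Lemma init_vec e : [seq b e | b <- init_fns] = vec (tm_init M (word I (nth 0 e 0))).
Proof.
rewrite /init_fns map_cons map_cat -!(map_comp _ _ (enum 'I_k)) [RHS]/vec; congr (_ :: _ ++ _); apply: eq_map => j /=.
  by rewrite /lnum /=; case: (j == ord0).
rewrite /rnum /=; case: (j == ord0) => /=; last by rewrite muln0.
by rewrite input_numE; case: (word I _) => //=; rewrite muln0.
Qed.

Lemma rec_init_fns i : i < size init_fns -> rec (nth (fun=> 0) init_fns i).
Proof.
case: i => [_|i]; first exact: rec_const.
rewrite /= size_cat !(size_map _ (enum 'I_k)) size_enum_ord ltnS => hi.
rewrite nth_cat (size_map _ (enum 'I_k)) size_enum_ord; case: ltnP => h.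
  by rewrite (nth_map ord0) ?size_enum_ord //; exact: rec_zero.
rewrite (nth_map ord0) ?size_enum_ord; last by rewrite ltn_subLR.
case: (_ == ord0); last exact: rec_zero.
by apply: rec_input_num; exact: rec_var.
Qed.

Definition halts_in n s := tm_halting (iter s (@tm_step _ _ M) (tm_init M (word I n))).1.

Lemma recb_halts_in f g : rec f -> rec g -> recb (fun e => halts_in (f e) (g e)).
Proof.
apply: (rec_app2 (F := fun n s => nat_of_bool (halts_in n s))).
have hh : rec (fun e => \sum_(q <- enum (tm_state M)) (nth 0 e 0 == enum_rank q) * tm_halting q).
  apply: (rec_select (f := fun q _ => nat_of_bool (tm_halting q))) => q; last exact: rec_const.
  by apply: recb_eq; [exact: rec_var | exact: rec_const].
have sz : size step_fns = size init_fns by rewrite /= !size_cat !(size_map _ (enum 'I_k)).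
apply: (rec_ext _ (rec_viter sz rec_init_fns rec_step_fns (rec_var _ _ 1) hh)) => e /=.
have -> m : iter m (fun acc => [seq s (acc ++ e) | s <- step_fns]) [seq b e | b <- init_fns] =
    vec (iter m (@tm_step _ _ M) (tm_init M (word I (nth 0 e 0)))).
  by elim: m => [|m IH]; [exact: init_vec | rewrite iterS IH step_vec].
rewrite /halts_in; set c := iter _ _ _.
rewrite (select_eq (b := fun q => nth 0 (vec c) 0 == enum_rank q)
  (fun q => nat_of_bool (tm_halting q)) (t := c.1)) // => q.
by rewrite /= eq_sym (inj_eq val_inj) (inj_eq enum_rank_inj).
Qed.

Lemma halts_in_mono n s s' : s <= s' -> halts_in n s -> halts_in n s'.
Proof.
move=> /subnK <-; rewrite /halts_in iterD; set c := iter s _ _ => hc.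
suff -> : iter (s' - s) (@tm_step _ _ M) c = c by [].
by elim: (s' - s) => //= m ->; case: (c) hc => q t /= ->.
Qed.

End Simulation.

(** * Greedy search *)

Definition digit b a w := (a %/ b ^ w) %% b.

Lemma digit_add b q a i : 0 < b -> q < b ^ i -> a < b -> digit b (q + a * b ^ i) i = a.
Proof.
move=> b0 qi ab; rewrite /digit addnC divnMDl ?expn_gt0 ?b0 //.
by rewrite divn_small // addn0 modn_small.
Qed.

Lemma digit_add_lt b q a i j : 0 < b -> j < i -> digit b (q + a * b ^ i) j = digit b q j.
Proof.
move=> b0 ji; rewrite /digit addnC -{1}(subnK ji) -addSnnS expnD mulnA.
rewrite divnMDl ?expn_gt0 ?b0 // expnS (mulnC b) mulnA modnMDl //.
Qed.

Section Greedy.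
Variables I O : finType.
Local Notation rec := (rec I O).
Local Notation recb := (recb I O).

Lemma rec_digit b f g : 0 < b -> rec f -> rec g -> rec (fun e => digit b (f e) (g e)).
Proof.
move=> b0 hf hg; apply: rec_modn => //; last exact: rec_const.
apply: rec_divn => //; first by move=> e; rewrite expn_gt0 b0.
by apply: rec_exp => //; exact: rec_const.
Qed.

(** [R i q t] stands for the confirmation, at stage [t], of the word formed by the first [i] digits
    of [q]. Every confirmed word has a confirmed extension, so the search may commit to the first
    one that it finds. *)
Variables (R : nat -> nat -> nat -> bool) (b : nat).
Hypothesis b_gt0 : 0 < b.
Hypothesis recR : recb (fun e => R (nth 0 e 0) (nth 0 e 1) (nth 0 e 2)).
Hypothesis R0 : exists t, R 0 0 t.
Hypothesis R_extend : forall i q, q < b ^ i -> (exists t, R i q t) ->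
  exists2 a, a < b & exists t, R i.+1 (q + a * b ^ i) t.

(* The number c enumerates the pairs of a next digit c %% b and a stage c %/ b. *)
Definition next_q i q c := q + c %% b * b ^ i.
Definition found i q c := R i.+1 (next_q i q c) (c %/ b).
Definition search (s : nat * nat * nat) :=
  let: (i, q, c) := s in
  if found i q c then (i.+1, next_q i q c, 0) else (i, q, c.+1).
Definition run m := iter m search (0, 0, 0).

Lemma run_inv m : (exists t, R (run m).1.1 (run m).1.2 t) /\ (run m).1.2 < b ^ (run m).1.1.
Proof.
elim: m => [|m]; first by rewrite expn0.
rewrite /run /= -/(run m); case: (run m) => [[i q] c] /= [ht hq].
case: ifP => // hf; split; first by exists (c %/ b).
apply: (@leq_trans ((c %% b).+1 * b ^ i)); first by rewrite mulSn ltn_add2r.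
by rewrite expnS leq_mul2r ltn_pmod // orbT.
Qed.

Lemma run_progress k : exists m, (run m).1.1 = k /\ (run m).2 = 0.
Proof.
elim: k => [|k [m [hk hc]]]; first by exists 0.
have [hR hq] := run_inv m.
case hs: (run m) hk hc hR hq => [[i q] c] /= ik c0; rewrite {}ik {}c0 in hs * => hR hq.
have [a ab [t ht]] := R_extend hq hR.
have ex : exists c, found k q c.
  exists (t * b + a); rewrite /found /next_q modnMDl modn_small //.
  by rewrite divnMDl // divn_small // addn0.
have hc' c' : c' <= ex_minn ex -> run (c' + m) = (k, q, c').
  elim: c' => [|c' IH] hc'; first by rewrite hs.
  rewrite addSn /run /= -/(run _) IH; last exact: ltnW.
  rewrite /search; case: ifP => // hf; case: ex_minnP hc' => c0 _ /(_ _ hf).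
  by rewrite leqNgt => /negbTE ->.
exists (ex_minn ex + m).+1; rewrite /run /= -/(run _) hc' //.
by case: ex_minnP => c0 /= ->.
Qed.

Lemma run_mono m : (run m).1.1 <= (run m.+1).1.1.
Proof. by rewrite /run /= -/(run m); case: (run m) => [[i q] c] /=; case: ifP. Qed.

Lemma run_stable j m m' : m <= m' -> j < (run m).1.1 ->
  j < (run m').1.1 /\ digit b (run m').1.2 j = digit b (run m).1.2 j.
Proof.
move=> /subnK <- hj; elim: (m' - m) => // n [h1 h2].
rewrite addSn; split; first exact: leq_trans h1 (run_mono _).
rewrite -h2 /run /= -/(run (n + m)); case: (run (n + m)) h1 => [[i q] c] /= h1.
by case: ifP => // _; rewrite digit_add_lt.
Qed.

Lemma run_reaches j : exists m, j < (run m).1.1.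
Proof. by have [m [h _]] := run_progress j.+1; exists m; rewrite h. Qed.

(** Digit [j] is read off as soon as it has been chosen; by [run_stable] it never changes
    afterwards. *)
Definition greedy j := digit b (run (ex_minn (run_reaches j))).1.2 j.

Lemma rec_run h m : rec h -> rec m ->
  rec (fun e => h [:: (run (m e)).1.1; (run (m e)).1.2; (run (m e)).2]).
Proof.
move=> hh hm.
have h0 : rec (fun e => nth 0 e 0) by exact: rec_var.
have h1 : rec (fun e => nth 0 e 1) by exact: rec_var.
have h2 : rec (fun e => nth 0 e 2) by exact: rec_var.
have hq : rec (fun e => next_q (nth 0 e 0) (nth 0 e 1) (nth 0 e 2)).
  apply: rec_add => //; apply: rec_mul.
    by apply: rec_modn => //; exact: rec_const.
  by apply: rec_exp => //; exact: rec_const.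
have hf : recb (fun e => found (nth 0 e 0) (nth 0 e 1) (nth 0 e 2)).
  apply: (rec_app3 (F := fun i q t => nat_of_bool (R i q t))) => //; first exact: rec_succ.
  by apply: rec_divn => //; exact: rec_const.
pose ss := [:: fun e : seq nat => if found (nth 0 e 0) (nth 0 e 1) (nth 0 e 2) then (nth 0 e 0).+1 else nth 0 e 0;
  fun e => if found (nth 0 e 0) (nth 0 e 1) (nth 0 e 2) then next_q (nth 0 e 0) (nth 0 e 1) (nth 0 e 2) else nth 0 e 1;
  fun e => if found (nth 0 e 0) (nth 0 e 1) (nth 0 e 2) then 0 else (nth 0 e 2).+1].
have H := @rec_viter I O [:: fun=> 0; fun=> 0; fun=> 0] ss m h erefl.
apply: (rec_ext _ (H _ _ hm hh)).
- move=> e; congr h; rewrite [map _ _]/=; elim: (m e) => // n IH; rewrite iterS {}IH.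
  by rewrite /run /= -/(run n); case: (run n) => [[i q] c] /=; case: ifP.
- by case=> [|[|[|]]] // _; exact: rec_zero.
- case=> [|[|[|]]] // _; apply: rec_if => //; try exact: rec_succ; exact: rec_zero.
Qed.

Lemma rec_greedy : rec (fun e => greedy (nth 0 e 0)).
Proof.
have hmin : rec (fun e => ex_minn (run_reaches (nth 0 e 0))).
  apply: (rec_mu (f := fun e => nat_of_bool ((run (nth 0 e 0)).1.1 <= nth 0 e 1))).
  - apply: (rec_app2 (F := fun i j => nat_of_bool (i <= j))); last exact: rec_var.
      exact: (recb_leq (@rec_var I O 0) (@rec_var I O 1)).
    by apply: (rec_run (h := fun e => nth 0 e 0)); exact: rec_var.
  - by move=> e /=; case: ex_minnP => m /=; rewrite ltnNge => /negbTE ->.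
  - move=> e m /=; case: ex_minnP => m0 _ hm0 hm; rewrite eqb0 negbK leqNgt.
    by apply/negP => /hm0; rewrite leqNgt hm.
apply: rec_digit => //; last exact: rec_var.
exact: (rec_run (h := fun e => nth 0 e 1)) (rec_var _ _ _) hmin.
Qed.

Lemma greedyP i : exists q, (exists t, R i q t) /\ forall j, j < i -> greedy j = digit b q j.
Proof.
have [m [hi _]] := run_progress i; have [hR _] := run_inv m.
exists (run m).1.2; rewrite hi in hR; split=> // j ji; rewrite /greedy.
case: ex_minnP => m0 hm0 hmin.
have hj : j < (run m).1.1 by rewrite hi.
by have [_ ->] := run_stable (hmin _ hj) hm0.
Qed.

Lemma greedy_lt j : greedy j < b.
Proof. exact: ltn_pmod. Qed.

End Greedy.

(** * Refutation of local constraints *)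

(** König's lemma for [b]-ary sequences: [Q t] depends on the first [t] values only and gets
    stronger with [t]. The branch is built from live prefixes, those that extend to solutions at
    every stage. *)
Lemma konig b (Q : nat -> (nat -> nat) -> Prop) :
  (forall t, exists2 u, forall v, u v < b & Q t u) ->
  (forall t t' u u', t <= t' -> (forall v, v < t -> u v = u' v) -> Q t' u' -> Q t u) ->
  exists2 u, forall v, u v < b & forall t, Q t u.
Proof.
move=> Qex Qmono.
pose live (s : seq nat) := forall t, exists u,
  [/\ forall v, u v < b, Q t u & forall v, v < size s -> u v = nth 0 s v].
have live0 : live [::] by move=> t; have [u hu hQ] := Qex t; exists u.
have liveS s : exists c, live s -> c < b /\ live (rcons s c).
  have [hs|] := pselect (live s); last by exists 0.
  apply: contrapT => hno.
  have [T hT] : exists T : nat -> nat, forall c, c < b -> ~ exists u,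
    [/\ forall v, u v < b, Q (T c) u & forall v, v < size (rcons s c) -> u v = nth 0 (rcons s c) v].
    suff /choice[T hT] : forall c, exists t, c < b -> ~ exists u,
      [/\ forall v, u v < b, Q t u & forall v, v < size (rcons s c) -> u v = nth 0 (rcons s c) v].
      by exists T.
    move=> c; apply: contrapT => h; apply: hno; exists c => _; split.
      by apply: contrapT => hc; apply: h; exists 0.
    move=> t; apply: contrapT => h'; apply: h; exists t => _; exact: h'.
  (* [T c] is a stage that excludes the next letter [c]. A solution at the largest of these stages
     has some next letter, and contradicts its exclusion. *)
  have [u [hu hQ hus]] := hs (\max_(c < b) T c).
  apply: (hT (u (size s)) (hu _)); exists u; split=> //.
    by apply: Qmono hQ => //; exact: (leq_bigmax (Ordinal (hu (size s)))).
  move=> v; rewrite size_rcons ltnS leq_eqVlt nth_rcons => /predU1P[->|hv].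
    by rewrite ltnn eqxx.
  by rewrite hv hus.
have [f hf] := choice liveS.
pose s n := iter n (fun s => rcons s (f s)) [::].
have szs n : size (s n) = n by elim: n => //= n IH; rewrite size_rcons IH.
have lives n : live (s n).
  by elim: n => // n IH; rewrite /s /= -/(s n); case: (hf _ IH).
have nths n v : v < n -> nth 0 (s n) v = f (s v).
  elim: n => // n IH; rewrite ltnS /s /= -/(s n) nth_rcons szs leq_eqVlt => /predU1P[->|hv].
    by rewrite ltnn eqxx.
  by rewrite hv IH.
exists (fun n => f (s n)) => [v|t]; first by case: (hf _ (lives v)).
have [u [hu hQ hus]] := lives t t.
apply: Qmono hQ => // v hv; rewrite hus ?szs // nths //.
Qed.

Lemma digits_of b (u : nat -> nat) t : (forall v, u v < b) ->
  exists2 a, a < b ^ t & forall v, v < t -> digit b a v = u v.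
Proof.
move=> hu; have b0 : 0 < b := leq_ltn_trans (leq0n _) (hu 0).
elim: t => [|t [a ha hd]]; first by exists 0; rewrite ?expn0.
exists (a + u t * b ^ t).
  apply: (@leq_trans ((u t).+1 * b ^ t)); first by rewrite mulSn ltn_add2r.
  by rewrite expnS leq_mul2r hu orbT.
move=> v; rewrite ltnS leq_eqVlt => /predU1P[->|hv]; first by rewrite digit_add.
by rewrite digit_add_lt // hd.
Qed.

Section Refutation.
Variables (G : groupType) (I O : finType) (M : turing_machine I O) (ev : seq I -> G).
Hypothesis I_gt0 : 0 < #|I|.
Hypothesis ev_cat : forall u v, ev (u ++ v) = (ev u * ev v)%g.
Hypothesis ev_surj : forall g, exists w, ev w = g.
Hypothesis M_halts : forall w, ev w = 1%g <-> tm_halts M w.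

Definition element n : G := ev (word I n).
Local Notation catw := (catw I).

Lemma element_cat v w : element (catw v w) = (element v * element w)%g.
Proof. by rewrite /element word_catw. Qed.

Lemma element_surj g : exists n, element n = g.
Proof. by have [w <-] := ev_surj g; exists (word_code w); rewrite /element word_codeK. Qed.

Lemma element0 : element 0 = 1%g.
Proof. by apply: (mulgI (element 0)); rewrite -element_cat mulg1. Qed.

Lemma element_halts n : element n = 1%g <-> exists s, halts_in M n s.
Proof. exact: M_halts. Qed.

Variables (b b' : nat) (pr : nat -> nat) (rules : seq (nat * (nat -> nat -> bool))).
Hypothesis b_gt0 : 0 < b.

(* (i, q) stands for the pattern whose letter at element j, for j < i, is the j-th
   digit of q in base b'. *)
Definition occurs i q (z : G -> nat) (g : G) :=
  forall j, j < i -> pr (z (g * element j)%g) = digit b' q j.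

Definition admissible (z : G -> nat) :=
  (forall g, z g < b) /\
  forall g r, r \in rules -> r.2 (z g) (z (g * element r.1)%g) = false.

Definition avoids i q beta z :=
  [/\ admissible z, z 1%g = beta & forall g, ~ occurs i q z g].

(* Here u assigns letters to words. Two words v, w have the same value iff
   v v' and w v' are trivial for some v', and this is eventually detected. *)
Definition violation i q beta t (u : nat -> nat) : bool :=
  [|| (0 < t) && (u 0 != beta),
    [exists v : 'I_t, [exists w : 'I_t, [exists v' : 'I_t,
      [&& halts_in M (catw v v') t, halts_in M (catw w v') t & u v != u w]]]],
    has (fun r => [exists w : 'I_t, (catw w r.1 < t) && r.2 (u w) (u (catw w r.1))]) rules |
    [exists w : 'I_t, [forall j : 'I_i, (catw w j < t) && (pr (u (catw w j)) == digit b' q j)]]].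

(** The digits of the numbers [a < b ^ t] run through all assignments of letters to the first [t]
    words, so each stage is a finite check. *)
Definition refuted i q t :=
  [exists beta : 'I_b, [forall a : 'I_(b ^ t), violation i q beta t (digit b a)]].

Lemma violation_mono i q beta t t' u u' : t <= t' -> (forall v, v < t -> u v = u' v) ->
  violation i q beta t u -> violation i q beta t' u'.
Proof.
move=> tt' uu'; case/or4P => [/andP[t0 h]|||].
- by apply/or4P/Or41; rewrite -uu' // h (leq_trans t0).
- case/existsP=> v /existsP[w /existsP[v' /and3P[h1 h2 h3]]].
  apply/or4P/Or42; apply/existsP; exists (widen_ord tt' v); apply/existsP.
  exists (widen_ord tt' w); apply/existsP; exists (widen_ord tt' v').
  by rewrite /= (halts_in_mono tt' h1) (halts_in_mono tt' h2) -!uu'.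
- case/hasP=> r hr /existsP[w /andP[h1 h2]].
  apply/or4P/Or43; apply/hasP; exists r => //; apply/existsP; exists (widen_ord tt' w).
  by rewrite /= (leq_trans h1) // -!uu'.
- case/existsP=> w /forallP h; apply/or4P/Or44; apply/existsP; exists (widen_ord tt' w).
  apply/forallP => j; have /andP[h1 h2] := h j.
  by rewrite /= (leq_trans h1) // -uu'.
Qed.

Lemma violation_ext i q beta t u u' : (forall v, v < t -> u v = u' v) ->
  violation i q beta t u = violation i q beta t u'.
Proof.
by move=> h; apply/idP/idP; apply: violation_mono => // v hv; rewrite h.
Qed.

Lemma violation_avoids i q beta t z : avoids i q beta z -> ~~ violation i q beta t (fun n => z (element n)).
Proof.
move=> [[zb zr] z1 zp]; apply/negP => /or4P[/andP[_]|||].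
- by rewrite element0 z1 eqxx.
- case/existsP=> v /existsP[w /existsP[v' /and3P[h1 h2 /negP]]]; apply; apply/eqP.
  have e1 : element (catw v v') = 1%g by apply/element_halts; exists t.
  have e2 : element (catw w v') = 1%g by apply/element_halts; exists t.
  by congr z; apply: (mulIg (element v')); rewrite -!element_cat e1.
- by case/hasP=> r hr /existsP[w /andP[_]]; rewrite element_cat zr.
- case/existsP=> w /forallP h; apply: (zp (element w)) => j ji.
  by have /andP[_ /eqP] := h (Ordinal ji); rewrite element_cat.
Qed.

(** An assignment without violations is constant on words of equal value: with [v'] representing the
    inverse, both concatenations are trivial and the machine halts on them at some stage. Hence [u]
    descends to a configuration on [G]. *)
Lemma avoids_limit i q beta u : (forall v, u v < b) ->
  (forall t, ~~ violation i q beta t u) -> exists z, avoids i q beta z.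
Proof.
move=> ub hu.
have u_element v w : element v = element w -> u v = u w.
  move=> vw; have [v' hv'] := element_surj (element v)^-1%g.
  have e1 : element (catw v v') = 1%g by rewrite element_cat hv' mulgV.
  have e2 : element (catw w v') = 1%g by rewrite element_cat -vw hv' mulgV.
  have /element_halts[s1 h1] := e1; have /element_halts[s2 h2] := e2.
  pose t := (v + w + v' + s1 + s2).+1.
  have s1t : s1 <= t by rewrite /t leqW // -addnA [s1 + _]addnC addnA leq_addl.
  have s2t : s2 <= t by rewrite /t leqW // leq_addl.
  have vt : v < t by rewrite ltnS -!addnA leq_addr.
  have wt : w < t by rewrite ltnS (addnC v) -!addnA leq_addr.
  have v't : v' < t by rewrite ltnS (addnC _ v') -!addnA leq_addr.
  apply/eqP/negPn/negP => huv; move/negP: (hu t); apply; apply/or4P/Or42.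
  apply/existsP; exists (Ordinal vt); apply/existsP; exists (Ordinal wt).
  apply/existsP; exists (Ordinal v't).
  by rewrite /= (halts_in_mono s1t h1) (halts_in_mono s2t h2).
have [c hc] := choice element_surj.
pose z g := u (c g).
have zE n : z (element n) = u n by apply: u_element.
exists z; split; first split.
- by move=> g; exact: ub.
- move=> g r hr; apply/negP; rewrite -(hc g) -element_cat !zE => hbad.
  pose t := (c g + catw (c g) r.1).+1.
  have wt : c g < t by rewrite ltnS leq_addr.
  move/negP: (hu t); apply; apply/or4P/Or43; apply/hasP; exists r => //.
  by apply/existsP; exists (Ordinal wt); rewrite /= hbad ltnS leq_addl.
- rewrite -element0 zE; apply/eqP/negPn/negP => h0.
  by move/negP: (hu 1); apply; apply/or4P/Or41.
- move=> g hocc.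
  pose t := (c g + \max_(j < i) catw (c g) j).+1.
  have wt : c g < t by rewrite ltnS leq_addr.
  move/negP: (hu t); apply; apply/or4P/Or44; apply/existsP; exists (Ordinal wt).
  apply/forallP => j; rewrite /= -zE element_cat hc hocc // eqxx andbT ltnS.
  by apply: leq_trans (leq_addl _ _); exact: (leq_bigmax j).
Qed.

(** From left to right, a configuration avoiding the pattern would give an assignment without
    violations at stage [t]. The converse is compactness: if no stage refuted [beta], [konig] would
    give an assignment that survives all stages. *)
Lemma refutedP i q :
  (exists t, refuted i q t) <-> exists2 beta, beta < b & forall z, ~ avoids i q beta z.
Proof.
split=> [[t /existsP[beta /forallP h]]|[beta hb hz]].
  exists beta => // z hz; have [[zb _] _ _] := hz.
  have [a ha had] := digits_of t (fun n => zb (element n)).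
  have := h (Ordinal ha); rewrite (@violation_ext _ _ _ _ _ (fun n => z (element n)) had).
  by move=> hv; move/negP: (violation_avoids t hz) => hn; apply: hn.
apply: contrapT => hno.
have [||u ub hu] := @konig b (fun t u => ~~ violation i q beta t u).
- move=> t; apply: contrapT => h; apply: hno; exists t.
  apply/existsP; exists (Ordinal hb); apply/forallP => a /=.
  apply/negPn/negP => hv; apply: h; exists (digit b a) => // v.
  exact: ltn_pmod.
- move=> t t' u u' tt' uu'; apply: contra; exact: violation_mono.
by have [z /hz] := avoids_limit ub hu.
Qed.

End Refutation.

(** * Refutation at a given stage is recursive *)

Section RefutedRec.
Variables (I0 O0 : finType).
Local Notation rec := (rec I0 O0).
Local Notation recb := (recb I0 O0).

(** Each bounded quantifier puts its variable in front of the environment, so an outer variable is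
    reached through one [behead] per quantifier. *)
Lemma rec_behead k i : rec (fun e => nth 0 (iter k behead e) i).
Proof.
apply: (rec_ext _ (rec_var _ _ (k + i))) => e.
by elim: k i => [|k IH] i //=; rewrite nth_behead -IH addSnnS.
Qed.

Variables (I O : finType) (M : turing_machine I O).
Variables (b b' : nat) (pr : nat -> nat) (rules : seq (nat * (nat -> nat -> bool))).
Hypotheses (b_gt0 : 0 < b) (b'_gt0 : 0 < b').

Lemma rec_catw f g : rec f -> rec g -> rec (fun e => catw I (f e) (g e)).
Proof.
move=> hf hg; apply: rec_add => //; apply: rec_mul => //.
by apply: rec_exp => //; exact: rec_const.
Qed.

Ltac rvar := first [exact: (rec_behead 0) | exact: (rec_behead 1) | exact: (rec_behead 2)
  | exact: (rec_behead 3) | exact: (rec_behead 4) | exact: (rec_behead 5)].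

(** Two letters are packed into one number below [b * b], to which [rec_table] applies. *)
Lemma recb_rule r f g : (forall e, f e < b) -> (forall e, g e < b) -> rec f -> rec g ->
  recb (fun e => r (f e) (g e)).
Proof.
move=> fb gb hf hg.
have h : rec (fun e => f e * b + g e).
  by apply: rec_add => //; apply: rec_mul => //; exact: rec_const.
have hb e : f e * b + g e < b * b.
  by apply: (@leq_trans ((f e).+1 * b)); rewrite ?mulSn ?[b + _]addnC ?ltn_add2l // -mulSnr leq_mul2r fb orbT.
apply: (rec_ext _ (@rec_table _ _ (fun n => nat_of_bool (r (n %/ b) (n %% b))) _ _ hb h)) => e.
by rewrite divnMDl // divn_small // addn0 modnMDl modn_small.
Qed.

(* The environment of the following is a, beta, i, q, t. *)
Lemma recb_violation : recb (fun e =>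
  violation M b' pr rules (nth 0 e 2) (nth 0 e 3) (nth 0 e 1) (nth 0 e 4) (digit b (nth 0 e 0))).
Proof.
have d_lt a w : digit b a w < b by exact: ltn_pmod.
apply: recb_or; [|apply: recb_or; [|apply: recb_or]].
- apply: recb_and; first by apply: recb_ltn; [exact: rec_zero | rvar].
  apply: recb_not; apply: recb_eq; last rvar.
  by apply: rec_digit => //; [rvar | exact: rec_zero].
- apply: (recb_exists (P := fun v e => [exists w : 'I_(nth 0 e 4), [exists v' : 'I_(nth 0 e 4),
      [&& halts_in M (catw I v v') (nth 0 e 4), halts_in M (catw I w v') (nth 0 e 4)
        & digit b (nth 0 e 0) v != digit b (nth 0 e 0) w]]])); last rvar.
  apply: (recb_exists (P := fun w e => [exists v' : 'I_(nth 0 (behead e) 4),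
      [&& halts_in M (catw I (nth 0 e 0) v') (nth 0 (behead e) 4),
          halts_in M (catw I w v') (nth 0 (behead e) 4)
        & digit b (nth 0 (behead e) 0) (nth 0 e 0) != digit b (nth 0 (behead e) 0) w]])); last rvar.
  apply: (recb_exists (P := fun v' e => 
      [&& halts_in M (catw I (nth 0 (behead e) 0) v') (nth 0 (behead (behead e)) 4),
          halts_in M (catw I (nth 0 e 0) v') (nth 0 (behead (behead e)) 4)
        & digit b (nth 0 (behead (behead e)) 0) (nth 0 (behead e) 0)
          != digit b (nth 0 (behead (behead e)) 0) (nth 0 e 0)])); last rvar.
  apply: recb_and; last apply: recb_and.
  + by apply: recb_halts_in; [apply: rec_catw; rvar | rvar].
  + by apply: recb_halts_in; [apply: rec_catw; rvar | rvar].
  + by apply: recb_not; apply: recb_eq; apply: rec_digit => //; rvar.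
- elim: rules => [|r l IH]; first exact: recb_const.
  apply: recb_or IH.
  apply: (recb_exists (P := fun w e => (catw I w r.1 < nth 0 e 4) &&
    r.2 (digit b (nth 0 e 0) w) (digit b (nth 0 e 0) (catw I w r.1)))); last rvar.
  have hc : rec (fun e => catw I (nth 0 e 0) r.1) by apply: rec_catw; [rvar | exact: rec_const].
  apply: recb_and; first by apply: recb_ltn => //; rvar.
  by apply: recb_rule => //; apply: rec_digit => //; rvar.
- apply: (recb_exists (P := fun w e => [forall j : 'I_(nth 0 e 2), (catw I w j < nth 0 e 4) &&
    (pr (digit b (nth 0 e 0) (catw I w j)) == digit b' (nth 0 e 3) j)])); last rvar.
  apply: (recb_forall (P := fun j e => (catw I (nth 0 e 0) j < nth 0 (behead e) 4) &&
    (pr (digit b (nth 0 (behead e) 0) (catw I (nth 0 e 0) j)) == digit b' (nth 0 (behead e) 3) j)));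
    last rvar.
  have hc : rec (fun e => catw I (nth 0 (behead e) 0) (nth 0 e 0)) by apply: rec_catw; rvar.
  apply: recb_and; first by apply: recb_ltn => //; rvar.
  apply: recb_eq; last by apply: rec_digit => //; rvar.
  by apply: (@rec_table _ _ pr b) => //; apply: rec_digit => //; rvar.
Qed.

Lemma recb_refuted : recb (fun e => refuted M b b' pr rules (nth 0 e 0) (nth 0 e 1) (nth 0 e 2)).
Proof.
apply: (recb_exists (P := fun beta e => [forall a : 'I_(b ^ nth 0 e 2),
  violation M b' pr rules (nth 0 e 0) (nth 0 e 1) beta (nth 0 e 2) (digit b a)])).
  apply: (recb_forall (P := fun a e => violation M b' pr rules (nth 0 (behead e) 0)
    (nth 0 (behead e) 1) (nth 0 e 0) (nth 0 (behead e) 2) (digit b a))).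
    by apply: (rec_ext _ recb_violation) => e; rewrite /= !nth_behead.
  by apply: rec_exp; [exact: rec_const | rvar].
exact: rec_const.
Qed.

End RefutedRec.

(** * The space of actions *)

Definition agree n (u w : nat -> bool) := forall i, i < n -> u i = w i.

Lemma agree_le n n' u w : n <= n' -> agree n' u w -> agree n u w.
Proof. by move=> h a i hi; apply: a; exact: leq_trans h. Qed.

Lemma agree_sym n u w : agree n u w -> agree n w u.
Proof. by move=> h i /h. Qed.

Lemma agree_trans n u v w : agree n u v -> agree n v w -> agree n u w.
Proof. by move=> h h' i hi; rewrite h // h'. Qed.

Lemma konig_bool (Q : nat -> (nat -> bool) -> Prop) :
  (forall t, exists u, Q t u) ->
  (forall t t' u u', t <= t' -> agree t u u' -> Q t' u' -> Q t u) ->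
  exists u, forall t, Q t u.
Proof.
move=> Qex Qmono.
have [||u ub hu] := @konig 2 (fun t u => Q t (fun v => u v == 1)).
- move=> t; have [u hu] := Qex t; exists (fun v => u v : nat).
    by move=> v; case: (u v).
  by apply: (Qmono t t _ u) => // v _; case: (u v).
- by move=> t t' u u' tt' uu'; apply: Qmono => // v hv; rewrite uu'.
by exists (fun v => u v == 1).
Qed.

Lemma nbhs_cantor (u : cantor_space) (V : set cantor_space) :
  nbhs u V -> exists n, forall w, agree n u w -> V w.
Proof.
pose F : set_system cantor_space := filter_from setT (fun n => [set w : cantor_space | agree n u w]).
have FF : Filter F.
  apply: filter_from_filter; first by exists 0.
  move=> i j _ _; exists (maxn i j) => // w h; split.
    exact: agree_le (leq_maxl _ _) h.
  exact: agree_le (leq_maxr _ _) h.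
suff cF : F --> u by move=> /cF [n _ hn]; exists n => w /hn.
apply/cvg_sup => i A [B [[C _ <-] Cu CA]]; exists i.+1 => // w hw.
by apply: CA; rewrite /= /proj -(hw i).
Qed.

Lemma entourage_coord i : entourage [set uw : cantor_space * cantor_space | uw.1 i = uw.2 i].
Proof.
set E := (X in entourage X).
have entD : entourage [set ab : bool * bool | ab.1 = ab.2] by move=> _ [x _ <-].
have ent_i : @entourage (initial_topology (@proj _ (fun=> bool) i)) E.
  by exists [set ab : bool * bool | ab.1 = ab.2].
(* The product uniformity is a supremum over the coordinates, with finite intersections of
   coordinate entourages as a base; here a single one is intersected. *)
exists E => //; pose p : {classic nat} * set (cantor_space * cantor_space) := (i, E).
have hp : `[< @entourage (Uniform.Pack (Uniform.class (initial_topology (@proj _ (fun=> bool) p.1)))) p.2 >].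
  exact/asboolP.
exists [fset (exist _ p hp)]%fset; first by move=> ? _; rewrite inE.
rewrite eqEsubset; split=> uw /=.
  by move=> /(_ (exist _ p hp)); apply; rewrite /= inE.
by move=> h q; rewrite /= inE => /eqP ->.
Qed.

Lemma entourage_agree n :
  entourage [set uw : cantor_space * cantor_space | agree n uw.1 uw.2].
Proof.
elim: n => [|n IH]; first by apply: filterS filterT => w.
apply: filterS (filterI IH (entourage_coord n)) => uw [h1 h2] i.
by rewrite ltnS leq_eqVlt => /predU1P[->|/h1].
Qed.

(** If pairs outside [E] agreed to every depth, they would accumulate at some point [u] by König's
    lemma, although pairs close enough to [u] lie in [E]. The uniform continuity in
    [continuous_modulus] has the same proof. *)
Lemma compact_entourage (E : set (cantor_space * cantor_space)) :
  entourage E -> exists n, forall u w, agree n u w -> E (u, w).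
Proof.
move=> entE; apply: contrapT => hno.
have [||u hu] := @konig_bool (fun t u => exists w w' : cantor_space,
  [/\ agree t u w, agree t u w' & ~ E (w, w')]).
- move=> t; apply: contrapT => h; apply: hno; exists t => u w huw.
  by apply: contrapT => hE; apply: h; exists u, u, w.
- move=> t t' u u' tt' uu' [w [w' [h1 h2 h3]]]; exists w, w'.
  by split=> //; apply: agree_trans uu' _; apply: agree_le tt' _.
pose E' := (split_ent E `&` (split_ent E)^-1)%relation.
have entE' : entourage E' by apply: entourage_invI; exact: entourage_split_ent.
have [n hn] := nbhs_cantor (nbhs_entourage (u : cantor_space) entE').
have [w [w' [/hn/xsectionP[_ h1] /hn/xsectionP[h2 _]]]] := hu n; apply.
exact: entourage_split h1 h2.
Qed.

Lemma continuous_modulus (f : cantor_space -> cantor_space) : continuous f ->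
  forall n, exists N, forall u w, agree N u w -> agree n (f u) (f w).
Proof.
move=> cf n; apply: contrapT => hno.
have [||u hu] := @konig_bool (fun t u => exists w w' : cantor_space,
  [/\ agree t u w, agree t u w' & ~ agree n (f w) (f w')]).
- move=> t; apply: contrapT => h; apply: hno; exists t => u w huw.
  by apply: contrapT => hE; apply: h; exists u, u, w.
- move=> t t' u u' tt' uu' [w [w' [h1 h2 h3]]]; exists w, w'.
  by split=> //; apply: agree_trans uu' _; apply: agree_le tt' _.
have hV : nbhs (f u) [set w : cantor_space | agree n (f u) w].
  by apply: filterS (nbhs_entourage (f u) (entourage_agree n)) => w /xsectionP.
have [N hN] := nbhs_cantor (cf u _ hV).
have [w [w' [/hN h1 /hN h2]]] := hu N; apply.
exact: agree_trans (agree_sym h1) h2.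
Qed.

Lemma modulus_continuous (f : cantor_space -> cantor_space) :
  (forall n, exists N, forall u w, agree N u w -> f u n = f w n) -> continuous f.
Proof.
move=> hf u; apply/cvg_sup => i A [B [[C _ <-] Cu CA]].
have [N hN] := hf i.
have hV : nbhs u [set w : cantor_space | agree N u w].
  by apply: filterS (nbhs_entourage (u : cantor_space) (entourage_agree N)) => w /xsectionP.
apply: filterS hV => w /hN hw; apply: CA.
by move: Cu; rewrite /= /proj hw.
Qed.

Section Actions.
Variable G : groupType.
Local Notation Act := (Act_cantor G).

Lemma act1 (a : Act) x : act_app a 1%g x = x.
Proof. by case: a => a /= ha; have [h _] := set_mem ha; exact: h. Qed.

Lemma actM (a : Act) g h x : act_app a (g * h)%g x = act_app a g (act_app a h x).
Proof. by case: a => a /= ha; have [_ h'] := set_mem ha; exact: h'. Qed.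

Lemma act_cont (a : Act) g : continuous (act_app a g : cantor_space -> cantor_space).
Proof. by rewrite /act_app /homeo_app; case: (set_val a g) => f hf; have [f' []] := set_mem hf. Qed.

(** A base of neighbourhoods of [a]: finitely many group elements are tested, uniformly in the
    point, on finitely many coordinates. *)
Definition act_near (a : Act) (F : seq G) n (c : Act) :=
  forall g, g \in F -> forall x, agree n (act_app a g x) (act_app c g x).

Lemma nbhs_act (a : Act) (V : set Act) : nbhs a V ->
  exists F n, forall c, act_near a F n c -> V c.
Proof.
pose Phi : set_system (Act_cantor G) := filter_from setT (fun p => [set c | act_near a p.1 p.2 c]).
have FPhi : Filter Phi.
  apply: filter_from_filter; first by exists ([::], 0).
  move=> [F1 n1] [F2 n2] _ _; exists (F1 ++ F2, maxn n1 n2) => // c /= h; split=> g hg x.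
    by apply: agree_le (leq_maxl _ _) _; apply: h; rewrite mem_cat hg.
  by apply: agree_le (leq_maxr _ _) _; apply: h; rewrite mem_cat hg orbT.
move=> [_ [[C oC <-] Ca CV]].
have cPhi : (set_val @ Phi : set_system {ptws G -> Homeo_cantor}) --> set_val a.
  apply/cvg_sup => g A [_ [[D oD <-] Da DA]].
  have : nbhs (set_val a g) D by exact: open_nbhs_nbhs.
  move=> [_ [[E oE <-] Ea ED]].
  have /uniform_nbhs[W [entW hW]] : nbhs (set_val (set_val a g)) E by exact: open_nbhs_nbhs.
  have [n hn] := compact_entourage entW.
  exists ([:: g], n) => // c hc; apply/DA/ED/hW => x _.
  by apply: hn; apply: hc; rewrite inE.
have [[F n] _ hF] := cPhi C (open_nbhs_nbhs (conj oC Ca)).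
by exists F, n => c /hF; exact: CV.
Qed.

Lemma act_near_nbhs (a : Act) F n : nbhs a [set c | act_near a F n c].
Proof.
elim: F => [|g F IH]; first by apply: filterS filterT => c.
have h : nbhs a [set c | forall x, agree n (act_app a g x) (act_app c g x)].
  pose U : set {uniform cantor_space -> cantor_space} :=
    [set f | forall x, agree n (act_app a g x) (f x)].
  have hU : nbhs (set_val (set_val a g)) U.
    apply/uniform_nbhs; exists [set uw : cantor_space * cantor_space | agree n uw.1 uw.2].
    by split=> [|f hf x]; [exact: entourage_agree | exact: hf].
  have c1 := @initial_continuous _ _ (set_val : Homeo_cantor -> {uniform cantor_space -> cantor_space}).
  have c2 := @proj_continuous _ (fun _ : G => Homeo_cantor) g.
  have c3 := @initial_continuous _ _ (set_val : Act -> {ptws G -> Homeo_cantor}).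
  exact: (c3 a _ (c2 _ _ (c1 _ _ hU))).
apply: filterS (filterI IH h) => c [h1 h2] g'.
by rewrite inE => /predU1P[->|/h1].
Qed.

End Actions.

Fixpoint bin m (u : nat -> bool) : nat := if m is m'.+1 then bin m' u + u m' * 2 ^ m' else 0.

Definition bit (n l : nat) : bool := digit 2 n l == 1.

Lemma bin_lt m u : bin m u < 2 ^ m.
Proof.
elim: m => //= m IH; apply: (@leq_trans ((u m).+1 * 2 ^ m)); first by rewrite mulSn ltn_add2r.
by rewrite expnS leq_mul2r; case: (u m); rewrite orbT.
Qed.

Lemma bit_bin m u l : l < m -> bit (bin m u) l = u l.
Proof.
rewrite /bit; elim: m => //= m IH; rewrite ltnS leq_eqVlt => /predU1P[->|hl].
  by rewrite digit_add ?bin_lt //; case: (u m).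
by rewrite digit_add_lt // IH.
Qed.

Lemma bin_agree m u w : agree m u w -> bin m u = bin m w.
Proof.
elim: m => //= m IH h; rewrite h // IH // => i hi; apply: h; exact: leqW.
Qed.

Lemma agree_bin m u w : bin m u = bin m w -> agree m u w.
Proof. by move=> h l hl; rewrite -(bit_bin u hl) h bit_bin. Qed.

Lemma bin_bit m n : n < 2 ^ m -> bin m (bit n) = n.
Proof.
elim: m n => [|m IH] n; first by rewrite expn0 ltnS leqn0 => /eqP.
move=> hn /=.
have hm : n %/ 2 ^ m < 2 by rewrite ltn_divLR ?expn_gt0 // -expnS.
rewrite [RHS](divn_eq n (2 ^ m)) addnC; congr (_ + _).
  rewrite /bit /digit modn_small //; congr (_ * _).
  by case: (n %/ 2 ^ m) hm => [|[|]].
rewrite -[RHS]IH ?ltn_pmod ?expn_gt0 //; apply: bin_agree => l hl.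
congr (_ == _); rewrite {1}(divn_eq n (2 ^ m)) addnC digit_add_lt //.
Qed.

Lemma mk_act (G : groupType) (f : G -> cantor_space -> cantor_space) :
  (forall x, f 1%g x = x) -> (forall g h x, f (g * h)%g x = f g (f h x)) ->
  (forall g, continuous (f g)) -> exists a : Act_cantor G, forall g x, act_app a g x = f g x.
Proof.
move=> f1 fM fc.
have hf g : homeomorphism (f g).
  exists (f g^-1%g); split=> // x; first by rewrite -fM mulVg f1.
  by rewrite -fM mulgV f1.
pose a : {ptws G -> Homeo_cantor} :=
  fun g => exist (fun x => x \in [set f : {uniform cantor_space -> cantor_space} | homeomorphism f])
   (f g : {uniform cantor_space -> cantor_space}) (mem_set (hf g)).
have ha : is_action a by split=> [x|g h x]; [exact: f1 | exact: fM].
by exists (exist _ a (mem_set ha)).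
Qed.

(** * Baire category in the space of actions *)

Section Baire.
Variables (G : groupType) (elt : nat -> G).
Hypothesis elt_surj : forall g, exists n, elt n = g.
Local Notation Act := (Act_cantor G).

Lemma act_near_refl (a : Act) F n : act_near a F n a.
Proof. by move=> g _ x. Qed.

Lemma act_near_trans (a c d : Act) F n F' n' : act_near a F n c -> {subset F <= F'} -> n <= n' ->
  act_near c F' n' d -> act_near a F n d.
Proof.
move=> h1 hF hn h2 g hg x; apply: agree_trans (h1 g hg x) _.
by apply: agree_le hn _; apply: h2; exact: hF.
Qed.

Definition codings (p : cantor_space -> nat) (a : Act) : set (G -> nat) :=
  [set y | exists w, y = fun g => p (act_app a g^-1%g w)].

Definition local_code (ms : nat * seq nat) (w : cantor_space) := nth 0 ms.2 (bin ms.1 w).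

(** By uniform continuity [p (bin m (h w))] depends on the first [N] bits of [w] only and is given
    by a finite table. There are countably many tables, so the conjugates of [al] have countably
    many sets of codings. *)
Lemma codings_conj (al a : Act) m p : conjugacy_class al a ->
  exists ms, codings (fun w => p (bin m w)) a = codings (local_code ms) al.
Proof.
case=> h [h' [hK h'K hconj]].
have hc : continuous (homeo_app h : cantor_space -> cantor_space).
  by rewrite /homeo_app; case: (h) => f hf; have [f' []] := set_mem hf.
have [N hN] := continuous_modulus hc m.
pose q k := p (bin m (homeo_app h (bit k))).
exists (N, mkseq q (2 ^ N)).
have hq w : local_code (N, mkseq q (2 ^ N)) w = p (bin m (homeo_app h w)).
  rewrite /local_code /= nth_mkseq ?bin_lt // /q; congr p; apply/bin_agree/hN.
  by move=> l hl; rewrite bit_bin.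
rewrite eqEsubset; split=> y [w ->].
  by exists (homeo_app h' w); apply: funext => g; rewrite hq hconj.
by exists (homeo_app h w); apply: funext => g; rewrite hq hconj hK.
Qed.

Section Generic.
Variables (al : Act) (O : nat -> set Act).
Hypothesis O_open : forall k, open (O k).
Hypothesis O_dense : dense (\bigcap_k O k).
Hypothesis O_conj : \bigcap_k O k `<=` conjugacy_class al.
Variables (m : nat) (p : nat -> nat) (a0 : Act) (F0 : seq G) (n0 : nat).

Definition ball (s : Act * seq G * nat) : set Act := act_near s.1.1 s.1.2 s.2.

(** Some ball meeting [ball s] misses [Y], and the dense intersection enters it. The new ball also
    tests [elt k] and more than [k] coordinates, so that nested balls determine a limit. *)
Lemma generic_step (Y : set (G -> nat)) k s :
  (forall a F n, ball (a, F, n) `<=` ball s -> exists c F' n', ball (a, F, n) c /\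
     forall d, ball (c, F', n') d -> codings (fun w => p (bin m w)) d <> Y) ->
  exists s', [/\ ball s' `<=` ball s, ball s' `<=` O k,
    forall d, ball s' d -> codings (fun w => p (bin m w)) d <> Y &
    [/\ elt k \in s'.1.2, k < s'.2 & {subset s.1.2 <= s'.1.2}]].
Proof.
case: s => [[a F] n] /(_ a F n (fun _ h => h)) [c [F1 [n1 [hc hY]]]].
have hW := act_near_nbhs c (F1 ++ F) (maxn n1 n).
set W := (W in nbhs c W) in hW.
(* [W] is known only as a neighbourhood of [c], so density is applied to its interior. *)
have [|d [/interior_subset hd hD]] := O_dense (O := W^°) _ (open_interior W).
  by exists c.
have [F2 [n2 h2]] := nbhs_act (open_nbhs_nbhs (conj (O_open k) (hD k I))).
have subW e : act_near d (elt k :: F1 ++ F ++ F2) (maxn (maxn n1 n) (maxn n2 k.+1)) e -> W e.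
  apply: act_near_trans hd _ (leq_maxl _ _) => g hg.
  by rewrite inE catA mem_cat hg orbT.
exists (d, elt k :: F1 ++ F ++ F2, maxn (maxn n1 n) (maxn n2 k.+1)); split.
- move=> e /subW; apply: act_near_trans hc _ (leq_maxr _ _) => g hg.
  by rewrite mem_cat hg orbT.
- move=> e he; apply: h2 => g hg x; apply: agree_le (he g _ x).
    by rewrite (leq_trans (leq_maxl n2 k.+1)) // leq_maxr.
  by rewrite inE !mem_cat hg !orbT.
- move=> e /subW he; apply: hY => g hg x; apply: agree_le (leq_maxl _ _) (he g _ x).
  by rewrite mem_cat hg.
- split; first by rewrite /= inE eqxx.
    by rewrite /= (leq_trans (leq_maxr n2 k.+1)) // leq_maxr.
  by move=> g hg; rewrite /= inE !mem_cat hg !orbT.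
Qed.

(** Completeness of the space of actions: along the centres, coordinate [i] of the image of a point
    under [g] is constant from stage [K g i] on. *)
Lemma act_limit (s : nat -> Act * seq G * nat) :
  (forall k, ball (s k.+1) `<=` ball (s k)) ->
  (forall k, [/\ elt k \in (s k.+1).1.2, k < (s k.+1).2 & {subset (s k).1.2 <= (s k.+1).1.2}]) ->
  exists a, forall k, ball (s k) a.
Proof.
move=> sub hs.
have [idx hidx] := choice elt_surj.
have sF k k' : k <= k' -> {subset (s k).1.2 <= (s k').1.2}.
  move=> /subnK <-; elim: (k' - k) => // j IH g /IH.
  by rewrite addSn; have [_ _] := hs (j + k); apply.
have sball k k' : k <= k' -> ball (s k) (s k').1.1.
  move=> /subnK <-; suff : ball (s (k' - k + k)) `<=` ball (s k).
    by apply; exact: act_near_refl.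
  by elim: (k' - k) => // j IH; rewrite addSn; apply: subset_trans IH; exact: sub.
pose K g i := (maxn (idx g) i).+1.
have inK g i k : K g i <= k -> g \in (s k).1.2.
  move=> h; apply: (@sF (idx g).+1); first by apply: leq_trans h; rewrite ltnS leq_maxl.
  by rewrite -{1}(hidx g); have [] := hs (idx g).
have ltK i k : i < k -> i < (s k).2.
  by case: k => // k; rewrite ltnS => h; have [_ h' _] := hs k; exact: leq_ltn_trans h h'.
have iK g i k : K g i <= k -> i < k by apply: leq_trans; rewrite ltnS leq_maxr.
pose L g (w : cantor_space) : cantor_space := fun i => act_app (s (K g i)).1.1 g w i.
have LE k g w i : g \in (s k).1.2 -> i < (s k).2 -> L g w i = act_app (s k).1.1 g w i.
  move=> hg hi; rewrite /L; set k' := K g i.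
  have h1 := sball k (maxn k k') (leq_maxl _ _) g hg w i hi.
  have h2 := sball k' (maxn k k') (leq_maxr _ _) g (inK g i _ (leqnn _)) w i (ltK _ _ (iK g i _ (leqnn _))).
  by rewrite h1 h2.
have [|||a ha] := @mk_act G L.
- by move=> w; apply: funext => i; rewrite /L act1.
- move=> g h w; apply: funext => i.
  pose k := maxn (K g i) (maxn (K h i) (K (g * h)%g i)).
  have kg : K g i <= k by exact: leq_maxl.
  have kh : K h i <= k by rewrite (leq_trans (leq_maxl (K h i) (K (g * h)%g i))) // leq_maxr.
  have kgh : K (g * h)%g i <= k by rewrite (leq_trans (leq_maxr (K h i) (K (g * h)%g i))) // leq_maxr.
  have ki : i < (s k).2 := ltK _ _ (iK _ _ _ kg).
  (* Coordinate [i] after applying [g] depends on the first [N] coordinates of the image under [h].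
     From stage [k'] on these are the ones of the limit. *)
  have [N hN] := continuous_modulus (@act_cont G (s k).1.1 g) i.+1.
  pose k' := maxn k N.
  have kk' : k <= k' := leq_maxl _ _.
  have Nk' : N <= k' := leq_maxr _ _.
  have gk' := inK _ _ _ (leq_trans kg kk'); have hk' := inK _ _ _ (leq_trans kh kk').
  have ghk' := inK _ _ _ (leq_trans kgh kk').
  have ik' : i < (s k').2 by apply/ltK/(leq_trans _ kk')/(iK g).
  rewrite (LE k') // actM (LE k g _ i (inK _ _ _ kg) ki).
  rewrite -(sball k k' kk' g (inK _ _ _ kg) _ i ki).
  apply: (hN _ _ _ i (ltnSn i)) => j hj; apply/esym/LE => //.
  by apply: ltK; exact: leq_trans hj Nk'.
- move=> g; apply: modulus_continuous => i.
  have [N hN] := continuous_modulus (@act_cont G (s (K g i)).1.1 g) i.+1.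
  by exists N => u w /hN; apply.
by exists a => k g hg w i hi; rewrite ha (LE k).
Qed.

(** Otherwise each candidate [Yk k] can be avoided on a smaller ball. The action in all the nested
    balls lies in every [O k], hence is conjugate to [al], but its set of codings is none of the
    candidates. *)
Lemma generic_codings : exists Y a1 F1 n1,
  ball (a1, F1, n1) `<=` ball (a0, F0, n0) /\
  forall c F n, act_near a1 F1 n1 c ->
    exists2 d, act_near c F n d & codings (fun w => p (bin m w)) d = Y.
Proof.
apply: contrapT => hno.
pose Yk (k : nat) := codings (local_code (odflt (0, [::]) (@choice.unpickle (nat * seq nat)%type k))) al.
have step s k : exists s', ball s `<=` ball (a0, F0, n0) ->
  [/\ ball s' `<=` ball s, ball s' `<=` O k,
    forall d, ball s' d -> codings (fun w => p (bin m w)) d <> Yk k &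
    [/\ elt k \in s'.1.2, k < s'.2 & {subset s.1.2 <= s'.1.2}]].
  have [hs|hs] := pselect (ball s `<=` ball (a0, F0, n0)); last by exists s.
  have [|s' h] := @generic_step (Yk k) k s; last by exists s'.
  move=> a F n hsub; apply: contrapT => hno'; apply: hno.
  exists (Yk k), a, F, n; split; first exact: subset_trans hsub hs.
  move=> c F' n' hc; apply: contrapT => hd; apply: hno'; exists c, F', n'; split=> // d hd' hY.
  by apply: hd; exists d.
have [f hf] := choice (fun sk : Act * seq G * nat * nat => step sk.1 sk.2).
pose s := fix s k := if k is k'.+1 then f (s k', k') else (a0, F0, n0).
have s0 k : ball (s k) `<=` ball (a0, F0, n0).
  by elim: k => // k IH; have [h _ _ _] := hf (s k, k) IH; exact: subset_trans h IH.
have [||a ha] := @act_limit s.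
- by move=> k; have [] := hf (s k, k) (s0 k).
- by move=> k; have [] := hf (s k, k) (s0 k).
have aO : (\bigcap_k O k) a by move=> k _; have [_ h _ _] := hf (s k, k) (s0 k); exact/h/(ha k.+1).
have [ms hms] := codings_conj m p (O_conj aO).
have [_ _ h _] := hf (s (choice.pickle ms), choice.pickle ms) (s0 _).
by apply: (h a (ha (choice.pickle ms).+1)); rewrite hms /Yk /= choice.pickleK.
Qed.

End Generic.
End Baire.

(** * Realization of closed invariant sets *)

Section Splitting.
Variable K : set (nat -> bool).

(* The set of the prefixes of K is a pruned tree; keeping only the digits of a
   point of K at the branching nodes identifies K with the whole Cantor space. *)
Definition prefix_in n u := exists x, K x /\ agree n u x.
Definition put (u : nat -> bool) n b : nat -> bool := fun i => if i == n then b else u i.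
Definition branches n u := prefix_in n.+1 (put u n true) /\ prefix_in n.+1 (put u n false).
Definition nbranches u n := \sum_(i < n) `[< branches i u >].

(** The state is the prefix built so far with the number of digits of [c] already spent; at a node
    with a single child the digit is forced. *)
Fixpoint grow (c : nat -> bool) n : (nat -> bool) * nat :=
  if n is n'.+1 then
    let: (u, j) := grow c n' in
    if `[< branches n' u >] then (put u n' (c j), j.+1)
    else (put u n' `[< prefix_in n'.+1 (put u n' true) >], j)
  else (fun=> false, 0).

Definition expand c : nat -> bool := fun n => (grow c n.+1).1 n.
Definition contract x : nat -> bool :=
  fun j => x (xget 0 [set n | branches n x /\ nbranches x n = j]).

Hypothesis K0 : K !=set0.
Hypothesis K_closed : forall x, (forall n, prefix_in n x) -> K x.

Lemma put_agree u w n b : agree n u w -> agree n.+1 (put u n b) (put w n b).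
Proof. by move=> h i; rewrite /put; case: eqP => // ne; rewrite ltnS leq_eqVlt => /predU1P[//|/h]. Qed.

Lemma prefix_agree u w n : agree n u w -> prefix_in n u <-> prefix_in n w.
Proof.
move=> h; split=> -[x [Kx hx]]; exists x; split=> //.
  exact: agree_trans (agree_sym h) hx.
exact: agree_trans h hx.
Qed.

Lemma branches_agree u w n : agree n u w -> branches n u <-> branches n w.
Proof. by move=> h; rewrite /branches !(prefix_agree (put_agree _ h)). Qed.

Lemma nbranches_agree u w n : agree n u w -> nbranches u n = nbranches w n.
Proof.
move=> h; apply: eq_bigr => i _; congr nat_of_bool; apply/asbool_equiv_eq.
by apply: branches_agree; apply: agree_le h; exact: ltnW.
Qed.

Lemma put_id u n b : agree n (put u n b) u.
Proof. by move=> i hi; rewrite /put ltn_eqF. Qed.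

Lemma grow_agree c n k : agree n (grow c (k + n)).1 (grow c n).1.
Proof.
elim: k => // k IH; apply: agree_trans IH; rewrite addSn /=.
case: grow => u j; case: asboolP => _ /=; apply: agree_le (leq_addl k n) (put_id _ _).
Qed.

Lemma grow_expand c n : agree n (grow c n).1 (expand c).
Proof.
by move=> i hi; rewrite /expand -(subnK hi) (@grow_agree c i.+1 (n - i.+1)) // ltnSn.
Qed.

Lemma grow_prefix c n : prefix_in n (grow c n).1.
Proof.
elim: n => [|n /=]; first by have [x Kx] := K0; exists x.
case: grow => u j /= [x [Kx hx]].
case: asboolP => [[h1 h2]|hno] /=; first by case: (c j).
case: asboolP => // hf.
have hp : prefix_in n.+1 (put u n (x n)).
  exists x; split=> // i; rewrite /put; case: eqP => [->//|ne].
  by rewrite ltnS leq_eqVlt => /predU1P[//|/hx].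
by case: (x n) hp.
Qed.

Lemma expand_in c : K (expand c).
Proof. by apply: K_closed => n; apply/(prefix_agree (@grow_expand c n))/grow_prefix. Qed.

Lemma grow_nbranches c n : (grow c n).2 = nbranches (expand c) n.
Proof.
elim: n => [|n IH]; first by rewrite /nbranches big_ord0.
rewrite /nbranches big_ord_recr /= -/(nbranches _ _) -IH.
have := branches_agree (@grow_expand c n); case: (grow c n) => u j /= h.
by rewrite (asbool_equiv_eq h); case: ifP => _; rewrite /= ?addn1 ?addn0.
Qed.

Lemma expandE c n : expand c n =
  if `[< branches n (expand c) >] then c (nbranches (expand c) n)
  else `[< prefix_in n.+1 (put (expand c) n true) >].
Proof.
rewrite {1}/expand /= -grow_nbranches.
have h := @grow_expand c n; move: h (branches_agree h) (prefix_agree (put_agree true h)).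
case: (grow c n) => u j /= h /asbool_equiv_eq -> /asbool_equiv_eq ->.
by case: ifP => _ /=; rewrite /put eqxx.
Qed.

Lemma nbranches_inj x n n' : branches n x -> branches n' x ->
  nbranches x n = nbranches x n' -> n = n'.
Proof.
have lt i j : i < j -> branches i x -> nbranches x i < nbranches x j.
  move=> /subnK <- hi; elim: (j - i.+1) => [|k IH].
    rewrite add0n /nbranches big_ord_recr /=.
    by case: asboolP => // _; rewrite addn1.
  by rewrite addSn {2}/nbranches big_ord_recr /= -/(nbranches _ _) ltn_addr.
move=> h h' e; case: (ltngtP n n') => // [/lt/(_ h)|/lt/(_ h')]; by rewrite e ltnn.
Qed.

Lemma contract_at x n : branches n x -> contract x (nbranches x n) = x n.
Proof.
move=> hn; rewrite /contract; congr x.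
have [hb hc] : branches (xget 0 [set n' | branches n' x /\ nbranches x n' = nbranches x n]) x /\
   nbranches x (xget 0 [set n' | branches n' x /\ nbranches x n' = nbranches x n]) = nbranches x n.
  by case: xgetP => [n' _ []|/(_ n) []].
exact: nbranches_inj hc.
Qed.

Lemma contractK x : K x -> expand (contract x) = x.
Proof.
move=> Kx; suff h n : agree n (expand (contract x)) x.
  by apply: funext => n; exact: (h n.+1 n (ltnSn n)).
elim: n => // n IH i; rewrite ltnS leq_eqVlt => /predU1P[->|/IH //].
rewrite expandE (asbool_equiv_eq (branches_agree IH)) (nbranches_agree IH).
rewrite (asbool_equiv_eq (prefix_agree (put_agree true IH))).
have hx : prefix_in n.+1 (put x n (x n)).
  by exists x; split=> // j; rewrite /put; case: eqP => [->|].
case: asboolP => [hb|hb]; first exact: contract_at.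
by case: asboolP => ht; case: (x n) hx => // hx; case: hb; split.
Qed.

Variable m : nat.
(** A flippable coordinate is a branching one on all of [K]. If those below [m] are flippable,
    [contract] preserves the first [m] digits; if there are flippable ones at regular distances,
    every branch splits infinitely often and [contract] is uniformly continuous. *)
Definition flippable n := forall x, K x -> exists y, [/\ K y, agree n x y & y n != x n].
Hypothesis flippable_lt : forall n, n < m -> flippable n.
Hypothesis flippable_odd : forall k, flippable (m + k.*2.+1).

Lemma flippable_branches x n : K x -> flippable n -> branches n x.
Proof.
move=> Kx /(_ x Kx) [y [Ky xy yx]].
have hx : prefix_in n.+1 (put x n (x n)).
  by exists x; split=> // j; rewrite /put; case: eqP => [->|].
have hy : prefix_in n.+1 (put x n (y n)).
  exists y; split=> // j; rewrite /put; case: eqP => [->//|ne].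
  by rewrite ltnS leq_eqVlt => /predU1P[//|/xy].
by rewrite /branches; case: (x n) (y n) yx hx hy => -[].
Qed.

Lemma nbranches_lt x n : K x -> n <= m -> nbranches x n = n.
Proof.
move=> Kx hn; rewrite /nbranches (eq_bigr (fun=> 1)) ?sum_nat_const ?card_ord ?muln1 // => i _.
by rewrite asboolT //; apply: flippable_branches => //; apply: flippable_lt; exact: leq_trans hn.
Qed.

Lemma contract_lt x j : K x -> j < m -> contract x j = x j.
Proof.
move=> Kx hj; rewrite -{1}(nbranches_lt Kx (ltnW hj)); apply: contract_at.
exact/flippable_branches/flippable_lt.
Qed.

Lemma nbranches_odd x k : K x -> k <= nbranches x (m + k.*2).
Proof.
move=> Kx; elim: k => // k IH; rewrite doubleS !addnS /nbranches 2!big_ord_recr /=.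
rewrite -/(nbranches _ _) (_ : `[< branches (m + k.*2).+1 x >] = true) ?addn1 ?ltnS.
  by rewrite (leq_trans IH) // leq_addr.
by rewrite asboolT // -addnS; exact/flippable_branches/flippable_odd.
Qed.

(** Below this bound lie [j.+1] places of the form [m + k.*2.+1], all of them branching. The bound
    is thus a modulus of continuity for digit [j] of [contract]. *)
Lemma contract_ex x j : K x -> exists2 n, n < m + j.+1.*2 & branches n x /\ nbranches x n = j.
Proof.
move=> Kx; have := nbranches_odd j.+1 Kx; elim: (m + _) => [|n IH].
  by rewrite /nbranches big_ord0.
rewrite /nbranches big_ord_recr /= -/(nbranches _ _).
case: (ltnP j (nbranches x n)) => [/IH [n' hn' h] _|h1 h2].
  by exists n' => //; exact: leqW.
move: h2; case: asboolP => [hb|_]; last by rewrite addn0 ltnNge h1.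
by rewrite addn1 ltnS => h2; exists n => //; split=> //; apply/eqP; rewrite eqn_leq h1.
Qed.

Lemma expandK c : contract (expand c) = c.
Proof.
apply: funext => j; have [n _ [hb <-]] := contract_ex j (expand_in c).
by rewrite contract_at // expandE asboolT.
Qed.

Lemma expand_agree c c' n : agree n c c' -> agree n (expand c) (expand c').
Proof.
elim: n => // n IH h i; rewrite ltnS leq_eqVlt => /predU1P[->|]; last first.
  by apply: IH => j hj; apply: h; exact: leqW.
have {IH} IH : agree n (expand c) (expand c') by apply: IH => j hj; apply: h; exact: leqW.
rewrite !expandE (asbool_equiv_eq (branches_agree IH)) (nbranches_agree IH).
rewrite (asbool_equiv_eq (prefix_agree (put_agree true IH))) h // ltnS.
apply: (@leq_trans (\sum_(i < n) 1)); first by apply: leq_sum => k _; case: asboolP.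
by rewrite sum_nat_const card_ord muln1.
Qed.

Lemma contract_agree x x' j : K x -> K x' -> agree (m + j.+1.*2) x x' -> contract x j = contract x' j.
Proof.
move=> Kx Kx' h; have [n hn [hb hj]] := contract_ex j Kx.
have hn' : agree n x x' by apply: agree_le h; exact: ltnW.
rewrite -[in LHS]hj contract_at // -hj (nbranches_agree hn') contract_at ?h //.
exact/(branches_agree hn').
Qed.

End Splitting.

Section Realization.
Variables (G : groupType) (elt : nat -> G) (m : nat) (Z : set (G -> nat)).
Hypothesis elt_surj : forall g, exists n, elt n = g.
Hypothesis Z_lt : forall z g, Z z -> z g < 2 ^ m.
Hypothesis Z_closed : forall z, (forall F : seq G, exists2 z', Z z' & forall g, g \in F -> z' g = z g) -> Z z.
Hypothesis Z_shift : forall z g, Z z -> Z (fun h => z (g^-1 * h)%g).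
Hypothesis Z_full : forall b, b < 2 ^ m -> exists2 z, Z z & z 1%g = b.

(* A configuration z and a point c of the Cantor space are interleaved in one
   sequence: first the digits of z at 1, then the digits of all letters of z at
   the even places and c at the odd ones. *)
Definition interleave (z : G -> nat) (c : nat -> bool) : nat -> bool := fun n =>
  if n < m then bit (z 1%g) n else
  let k := (n - m)./2 in
  if odd (n - m) then c k else bit (z (elt (k %/ m))) (k %% m).

Definition number_of (g : G) : nat := xget 0 [set n | elt n = g].
Definition config_of (x : nat -> bool) : G -> nat :=
  fun g => bin m (fun l => x (m + (number_of g * m + l).*2)).
Definition point_of (x : nat -> bool) : nat -> bool := fun k => x (m + k.*2.+1).

Lemma number_ofK g : elt (number_of g) = g.
Proof.
rewrite /number_of; case: xgetP => [n _ //|h].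
by have [n hn] := elt_surj g; case: (h n).
Qed.

Lemma interleave_lt z c n : n < m -> interleave z c n = bit (z 1%g) n.
Proof. by rewrite /interleave => ->. Qed.

Lemma interleave_odd z c k : interleave z c (m + k.*2.+1) = c k.
Proof.
by rewrite /interleave ltnNge leq_addr /= addKn /= odd_double /= uphalf_double.
Qed.

Lemma interleave_even z c k : interleave z c (m + k.*2) = bit (z (elt (k %/ m))) (k %% m).
Proof. by rewrite /interleave ltnNge leq_addr /= addKn odd_double doubleK. Qed.

Lemma interleave_config z c : Z z -> config_of (interleave z c) = z.
Proof.
move=> Zz; apply: funext => g; rewrite /config_of -[RHS](bin_bit (Z_lt g Zz)).
apply: bin_agree => l hl; have m0 : 0 < m by exact: leq_ltn_trans hl.
by rewrite interleave_even divnMDl // divn_small // addn0 modnMDl modn_small // number_ofK.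
Qed.

Lemma interleave_point z c : point_of (interleave z c) = c.
Proof. by apply: funext => k; rewrite /point_of interleave_odd. Qed.

Lemma interleave_mod z z' c c' n : z 1%g = z' 1%g -> z (elt ((n - m)./2 %/ m)) = z' (elt ((n - m)./2 %/ m)) ->
  c (n - m)./2 = c' (n - m)./2 -> interleave z c n = interleave z' c' n.
Proof. by rewrite /interleave => -> -> ->. Qed.

Definition interleaved : set (nat -> bool) := [set x | exists z c, Z z /\ x = interleave z c].

Lemma interleavedK x : interleaved x -> interleave (config_of x) (point_of x) = x /\ Z (config_of x).
Proof. by move=> [z [c [Zz ->]]]; rewrite interleave_config // interleave_point. Qed.

Lemma config_of_agree g : exists N, forall x x', agree N x x' -> config_of x g = config_of x' g.
Proof.
exists (m + (number_of g * m + m).*2) => x x' h; apply: bin_agree => l hl; apply: h.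
by rewrite ltn_add2l ltn_double ltn_add2l.
Qed.

Lemma config_of_agree_seq (F : seq G) : exists N, forall x x', agree N x x' ->
  forall g, g \in F -> config_of x g = config_of x' g.
Proof.
elim: F => [|g F [N hN]]; first by exists 0.
have [N' hN'] := config_of_agree g; exists (maxn N N') => x x' h g'.
rewrite inE => /predU1P[->|]; first by apply: hN'; exact: agree_le (leq_maxr _ _) h.
by apply: hN; exact: agree_le (leq_maxl _ _) h.
Qed.

Lemma interleaved_closed x : (forall n, prefix_in interleaved n x) -> interleaved x.
Proof.
move=> hx; exists (config_of x), (point_of x); split.
  apply: Z_closed => F; have [N hN] := config_of_agree_seq F.
  have [y [/interleavedK[_ hy] xy]] := hx N; exists (config_of y) => // g gF.
  by rewrite (hN _ _ xy g gF).
apply: funext => n.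
have [N hN] := config_of_agree_seq [:: 1%g; elt ((n - m)./2 %/ m)].
pose N' := maxn N (maxn n.+1 (m + (n - m)./2.*2.+1).+1).
have [y [/interleavedK[hy _] xy]] := hx N'.
have xyN := hN _ _ (agree_le (leq_maxl _ _) xy).
have n1 : n < N' by rewrite (leq_trans (leq_maxl n.+1 (m + (n - m)./2.*2.+1).+1)) // leq_maxr.
have n2 : m + (n - m)./2.*2.+1 < N'.
  by rewrite (leq_trans (leq_maxr n.+1 (m + (n - m)./2.*2.+1).+1)) // leq_maxr.
rewrite (xy n n1) -hy; apply/esym/interleave_mod.
- by apply: xyN; rewrite inE eqxx.
- by apply: xyN; rewrite !inE eqxx orbT.
- exact: xy.
Qed.

(** Flipping a digit of [z 1%g] gives another letter below [2 ^ m], and by [Z_full] this letter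
    occurs at 1 in some configuration of [Z]. *)
Lemma interleaved_flippable_lt n : n < m -> flippable interleaved n.
Proof.
move=> hn _ [z [c [Zz ->]]].
pose u := put (bit (z 1%g)) n (~~ bit (z 1%g) n).
have [z' Zz' z'1] := Z_full (bin_lt m u).
exists (interleave z' c); split; first by exists z', c.
  move=> i hi; have im := ltn_trans hi hn.
  by rewrite !interleave_lt // z'1 bit_bin // /u /put ltn_eqF.
by rewrite !interleave_lt // z'1 bit_bin // /u /put eqxx; case: (bit _ _).
Qed.

Lemma interleaved_flippable_odd k : flippable interleaved (m + k.*2.+1).
Proof.
move=> _ [z [c [Zz ->]]]; exists (interleave z (put c k (~~ c k))); split.
- by exists z, (put c k (~~ c k)).
- move=> i hi; rewrite /interleave; case: ltnP => // im; case: ifP => // io.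
  rewrite /put ifF //; apply: contraTF hi => /eqP <-.
  suff e : m + (i - m)./2.*2.+1 = i by rewrite e ltnn.
  by rewrite -[RHS](subnKC im) -[X in _ = m + X](odd_double_half (i - m)) io.
- by rewrite !interleave_odd /put eqxx; case: (c k).
Qed.

(** The action is the shift on [z], trivial on [c], transported along [expand] and [contract]. The
    free digits [c] exclude isolated points even if [Z] is finite. The copy of [z 1%g] in front
    survives [contract], so the cylinder of length [m] around the image of [w] under [g^-1] is the
    letter [z g]. *)
Lemma realization : exists a : Act_cantor G,
  forall w : cantor_space, Z (fun g => bin m (act_app a g^-1%g w)).
Proof.
have K0 : interleaved !=set0.
  have [z Zz _] := Z_full (expn_gt0 2 m); by exists (interleave z (fun=> false)), z, (fun=> false).
have Kin := expand_in K0 interleaved_closed.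
pose zc g w := interleave (fun h => config_of (expand interleaved w) (g^-1 * h)%g) (point_of (expand interleaved w)).
pose f g (w : cantor_space) : cantor_space := contract interleaved (zc g w).
have hZ g w : Z (fun h => config_of (expand interleaved w) (g^-1 * h)%g).
  by apply: Z_shift; have [] := interleavedK (Kin w).
have zc_in g w : interleaved (zc g w).
  by exists (fun h => config_of (expand interleaved w) (g^-1 * h)%g), (point_of (expand interleaved w)).
have zcE g w : expand interleaved (f g w) = zc g w.
  exact: contractK (zc_in g w).
have [|||a ha] := @mk_act G f.
- move=> w; rewrite /f /zc.
  have -> : (fun h => config_of (expand interleaved w) (1^-1 * h)%g) = config_of (expand interleaved w).
    by apply: funext => h; rewrite invg1 mul1g.
  rewrite (interleavedK (Kin w)).1.
  exact: (expandK K0 interleaved_closed interleaved_flippable_odd).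
- move=> g h w; rewrite {2}/f; congr contract.
  rewrite {2}/zc zcE /zc interleave_config // interleave_point; congr interleave.
  by apply: funext => x; rewrite invgM mulgA.
- move=> g; apply: modulus_continuous => j.
  have [N hN] : exists N, forall w w', agree N w w' -> agree (m + j.+1.*2) (zc g w) (zc g w').
    elim: (m + j.+1.*2) => [|n [N hN]]; first by exists 0.
    have [N' hN'] := config_of_agree_seq [:: g^-1 * 1; g^-1 * elt ((n - m)./2 %/ m)]%g.
    exists (maxn N (maxn N' (m + (n - m)./2.*2.+1).+1)) => w w' h i.
    rewrite ltnS leq_eqVlt => /predU1P[->|hi]; last by apply: hN hi; exact: agree_le (leq_maxl _ _) h.
    have {}h := agree_le (leq_maxr _ _) h.
    have hz := hN' _ _ (expand_agree interleaved (agree_le (leq_maxl _ _) h)).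
    apply: interleave_mod.
    + by apply: hz; rewrite inE eqxx.
    + by apply: hz; rewrite !inE eqxx orbT.
    + by apply: (expand_agree interleaved h); exact: leq_maxr.
  exists N => w w' /hN h.
  exact: (contract_agree interleaved_flippable_odd (zc_in g w) (zc_in g w') h).
exists a => w.
suff -> : (fun g => bin m (act_app a g^-1%g w)) = config_of (expand interleaved w).
  by have [] := interleavedK (Kin w).
apply: funext => g; rewrite ha.
have hlt : config_of (expand interleaved w) g < 2 ^ m by apply: Z_lt; have [] := interleavedK (Kin w).
rewrite -[RHS](bin_bit hlt); apply: bin_agree => l hl.
rewrite /f (contract_lt interleaved_flippable_lt) // /zc interleave_lt //.
by rewrite invgK mulg1.
Qed.

End Realization.

(** * The theorem *)

Section Factor.
Variables (G : groupType) (A : finType) (X : set (fullshift G A)) (elt : nat -> G).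
Hypothesis elt_surj : forall g, exists n, elt n = g.

Definition letter_at (a : A) n : discrete_topology A := nth a (enum A) n.

(** Having its codings in [X] is an open condition on an action, as finitely many finite patterns
    decide it. It is satisfiable because [X], recoded with [2 ^ m] letters, is realized by an
    action. *)
Lemma SFT_open (x0 : fullshift G A) : SFT X -> X x0 -> exists m p a0 F0,
  (forall n, p n < #|A|) /\ forall c, act_near a0 F0 m c ->
    forall w, X (fun g => letter_at (x0 1%g) (p (bin m (act_app c g^-1%g w)))).
Proof.
move=> [[_ _ X_shift] [Fb XE]] Xx0; set la := letter_at (x0 1%g).
have rank_K (a : A) : la (enum_rank a) = a by rewrite /la /letter_at nth_enum_rank.
pose occ (a : A) := exists2 x, X x & x 1%g = a :> A.
(* Any [m] with [#|A| <= 2 ^ m] would do. Through [p] every cylinder receives a letter that occurs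
   in [X]; numbers that are not the rank of such a letter get the letter of [x0] at 1. *)
pose m := #|A|.
pose p n := if (n < #|A|) && `[< occ (la n) >] then n else enum_rank (x0 1%g : A).
have p_lt n : p n < #|A| by rewrite /p; case: ifP => [/andP[]|_]; last exact: ltn_ord.
have occ_p n : occ (la (p n)).
  rewrite /p; case: ifP => [/andP[_ /asboolP //]|_].
  by exists x0; rewrite ?rank_K.
have p_occ (a : A) : occ a -> p (enum_rank a) = enum_rank a.
  by move=> h; rewrite /p ltn_ord rank_K asboolT.
have X_avoid x : X x <-> forall q, q \in Fb -> ~ appears q x by rewrite XE.
pose Z : set (G -> nat) := [set z | (forall g, z g < 2 ^ m) /\ X (fun g => la (p (z g)))].
have [||||a0 ha0] := @realization G elt m Z elt_surj.
- by move=> z g [].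
- move=> z hz; split.
    by move=> g; have [z' [h _] /(_ g) <-] := hz [:: g]; rewrite ?inE.
  apply/X_avoid => q hq [g hg].
  have [z' [_ /X_avoid h] hF] := hz [seq (g^-1 * h)%g | h <- domf q].
  apply: (h q hq); exists g => k; rewrite -hg; rewrite /Defs.shift; rewrite hF //.
  by apply: map_f; exact: valP.
- by move=> z g [h1 h2]; split=> //; exact: (X_shift g _ h2).
- move=> b hb; have [x Xx xb] := occ_p b.
  (* A point of [X] with the letter of [p b] at 1, recoded by ranks except at 1, where the number
     must be [b] itself. *)
  exists (fun g => if g == 1%g then b else enum_rank (x g : A)); last by rewrite eqxx.
  split=> [g|].
    by case: ifP => // _; apply: ltn_trans (ltn_ord _) _; rewrite ltn_expl.
  suff -> : (fun g => la (p (if g == 1%g then b else enum_rank (x g : A)))) = x by [].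
  apply: funext => g; case: eqP => [->|_]; first by rewrite xb.
  rewrite p_occ ?rank_K //; exists (Defs.shift g^-1%g x); first exact: X_shift.
  by rewrite /Defs.shift invgK mulg1.
exists m, p, a0, [seq h^-1%g | h <- flatten [seq enum_fset (domf q) | q <- enum_fset Fb]].
split=> // c hc w; apply/X_avoid => q hq [g hg].
(* A forbidden pattern at [g] in the coding of [w] under [c] lies at 1 in the coding of
   [act_app c g w], and there [c] and [a0] give the same letters. *)
have [_ /X_avoid h] := ha0 (act_app c g w).
apply: (h q hq); exists 1%g => k; rewrite -hg /Defs.shift /= invg1 mul1g.
rewrite invgM invgK actM; congr (la (p _)); apply: bin_agree; apply: hc.
apply: map_f; apply/flattenP; exists (enum_fset (domf q)); last exact: valP.
exact: (map_f (fun q : {fmap G -> A} => enum_fset (domf q)) hq).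
Qed.

End Factor.

(** * The patterns of the generic set of codings *)

Section Language.
Variables (G : groupType) (I : finType) (ev : seq I -> G).
Local Notation elt := (element ev).
Hypothesis elt_surj : forall g, exists n, elt n = g.

Lemma language_avoids m p (Y : set (G -> nat)) (a1 : Act_cantor G) F1 n1 b' :
  (forall c F n, act_near a1 F1 n1 c ->
    exists2 d, act_near c F n d & codings (fun w => p (bin m w)) d = Y) ->
  exists b pr rules, 0 < b /\ forall i q,
    (exists2 beta, beta < b & forall z, ~ avoids ev b b' pr rules i q beta z) <->
    (exists2 y, Y y & forall j, j < i -> y (elt j) = digit b' q j).
Proof.
move=> dens.
have [idx hidx] := choice elt_surj.
(* Cylinders of length [M] are fine enough to determine the label [p] and, for [g] in [F1], the
   first [n1] digits of the images under [a1]. *)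
have [M [mM nM hM]] : exists M, [/\ m <= M, n1 <= M & forall g, g \in F1 ->
    forall u w, agree M u w -> agree n1 (act_app a1 g u) (act_app a1 g w)].
  have [M hM] : exists M, forall g, g \in F1 ->
      forall u w, agree M u w -> agree n1 (act_app a1 g u) (act_app a1 g w).
    elim: F1 {dens} => [|g F [N hN]]; first by exists 0.
    have [N' hN'] := continuous_modulus (@act_cont G a1 g) n1.
    exists (maxn N N') => g'; rewrite inE => /predU1P[->|/hN h] u w huw.
      by apply: hN'; exact: agree_le (leq_maxr _ _) huw.
    by apply: h; exact: agree_le (leq_maxl _ _) huw.
  exists (maxn M (maxn m n1)); split.
  - by rewrite (leq_trans (leq_maxl m n1)) // leq_maxr.
  - by rewrite (leq_trans (leq_maxr m n1)) // leq_maxr.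
  - by move=> g gF u w huw; apply: hM => //; exact: agree_le (leq_maxl _ _) huw.
pose pr n := p (bin m (bit n)).
(* The rules express closeness to [a1]: if [z h] is the cylinder of the image of [w] under [h^-1],
   then [z (h * g^-1)] is that of the further image under [g], and its first [n1] digits must be
   those prescribed by [a1]. *)
pose rules := [seq (idx g^-1%g, fun k l => bin n1 (bit l) != bin n1 (act_app a1 g (bit k))) | g <- F1].
exists (2 ^ M), pr, rules; split; first by rewrite expn_gt0.
have bitbin k u : k <= M -> agree k (bit (bin M u)) u.
  by move=> h l hl; rewrite bit_bin //; exact: leq_trans h.
move=> i q; split=> [[beta hbeta hno]|[y Yy hy]].
  (* An action with codings [Y] in the ball obeys the rules; the coding of a point in the cylinder
     [beta] therefore cannot avoid the pattern. *)
  have [d hd hY] := dens a1 F1 n1 (@act_near_refl _ _ _ _).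
  pose z g := bin M (act_app d g^-1%g (bit beta)).
  have zadm : admissible ev (2 ^ M) rules z.
    split=> [g|h r /mapP[g gF ->] /=]; first exact: bin_lt.
    apply/eqP; rewrite hidx; apply: bin_agree; apply: agree_trans (bitbin _ _ nM) _.
    rewrite invgM invgK actM; apply: agree_trans (agree_sym (hd g gF _)) _.
    by apply: hM => //; apply: agree_sym; exact: bitbin.
  have [g hocc] : exists g, occurs ev b' pr i q z g.
    apply: contrapT => h; apply: (hno z); split=> //; last by move=> g hg; apply: h; exists g.
    by rewrite /z invg1 act1 bin_bit.
  exists (fun h => p (bin m (act_app d h^-1%g (act_app d g^-1%g (bit beta))))).
    by rewrite -hY; exists (act_app d g^-1%g (bit beta)).
  move=> j ji; rewrite -hocc // /pr /z invgM actM; congr p.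
  by apply: bin_agree; apply: agree_sym; exact: bitbin.
apply: contrapT => hno.
pose Z : set (G -> nat) := [set z | admissible ev (2 ^ M) rules z /\ forall g, ~ occurs ev b' pr i q z g].
have [||||a ha] := @realization G elt M Z elt_surj.
- by move=> z g [[]].
- move=> z hz; split; first split.
  + by move=> g; have [z' [[h _] _] /(_ g) <-] := hz [:: g]; rewrite ?inE.
  + move=> g r hr; have [z' [[_ h] _] hF] := hz [:: g; (g * elt r.1)%g].
    by rewrite -!hF ?inE ?eqxx ?orbT // h.
  + move=> g hocc; have [z' [_ h] hF] := hz [seq (g * elt j)%g | j <- iota 0 i].
    apply: (h g) => j ji; rewrite hF ?hocc //.
    by apply: (map_f (fun j => (g * elt j)%g)); rewrite mem_iota.
- move=> z g [[h1 h2] h3]; split; first split.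
  + by move=> h; exact: h1.
  + by move=> h r hr; rewrite mulgA h2.
  + move=> h hocc; apply: (h3 (g^-1 * h)%g) => j ji.
    by rewrite -mulgA hocc.
- move=> beta hbeta; apply: contrapT => h; apply: hno; exists beta => // z [h1 h2 h3].
  by apply: h; exists z.
have near_a : act_near a1 F1 n1 a.
  move=> g gF w; have [[_ hr] _] := ha w.
  have /= := hr 1%g (idx g^-1%g, fun k l => bin n1 (bit l) != bin n1 (act_app a1 g (bit k))) (map_f _ gF).
  rewrite hidx mul1g !invgK invg1 act1 => /negbFE/eqP/agree_bin h.
  apply: agree_trans _ (agree_trans (agree_sym h) (bitbin _ _ nM)).
  by apply: hM => //; apply: agree_sym; exact: bitbin.
have [d hd hY] := dens a [seq (elt j)^-1%g | j <- iota 0 i] m near_a.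
move: Yy; rewrite -hY => -[w yE].
have [_ /(_ 1%g)] := ha w; apply => j ji; rewrite -hy // yE /pr mul1g; congr p.
apply: bin_agree; apply: agree_trans (bitbin _ _ mM) _; apply: hd.
by apply: (map_f (fun j => (elt j)^-1%g)); rewrite mem_iota.
Qed.

End Language.

Theorem theorem1p1 (G : groupType) (S : {fset G})
  (S_gen : symmetric_generating_set S)
  (G_infinite : infinite_set [set: G])
  (G_rp : recursively_presented S)
  (G_sft : exists (A : finType) (X : set (fullshift G A)),
     SFT X /\ ~ zero_medvedev_degree S X) :
  ~ STRP G.
Proof.
case: G_sft => A [X [Xsft hX]].
case=> al [D [DO D_dense D_conj]]; apply: hX; case: DO => O O_open DE.
case: S_gen => _ ev_surj; case: G_rp => M M_halts.
have [[[x0 Xx0] _ _] [Fb XE]] := Xsft.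
(* The base of the word numbers must be at least 2; an empty [S] would generate the trivial group,
   which is finite. *)
have I_gt0 : 0 < #|{: S}|.
  rewrite lt0n; apply/negP => /eqP S0; apply: G_infinite.
  suff -> : [set: G] = [set 1%g] by exact: finite_set1.
  rewrite eqEsubset; split=> // g _ /=.
  have [[|s w] <-] := ev_surj g; first by rewrite /word_eval big_nil.
  by have := fintype0 s S0.
have ev_cat (u v : seq S) : word_eval (u ++ v) = (word_eval u * word_eval v)%g.
  exact: big_cat.
pose elt := element (@word_eval G S).
have eltS : forall g, exists n, elt n = g := element_surj I_gt0 ev_surj.
rewrite DE in D_dense D_conj.
have [m [p [a0 [F0 [p_lt hU]]]]] := SFT_open eltS Xsft Xx0.
have [Y [a1 [F1 [n1 [ball1 dens]]]]] := generic_codings eltS O_open D_dense D_conj m p a0 F0 m.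
have [b [pr [rules [b_gt0 lang]]]] := language_avoids eltS #|A| dens.
have A_gt0 : 0 < #|A| by apply/card_gt0P; exists (x0 1%g).
pose R := refuted M b #|A| pr rules.
have RP i q : (exists t, R i q t) <-> exists2 y, Y y & forall j, j < i -> y (elt j) = digit #|A| q j.
  by rewrite -lang; exact: refutedP.
have [d near_d dY] := dens a1 F1 n1 (@act_near_refl _ _ _ _).
have YX y : Y y -> X (fun g => letter_at (x0 1%g) (y g)) /\ forall g, y g < #|A|.
  by rewrite -dY => -[w ->]; split=> //; apply: hU; exact: ball1.
have R0 : exists t, R 0 0 t.
  apply/RP; pose w : cantor_space := fun=> false.
  by exists (fun g => p (bin m (act_app d g^-1%g w))) => //; rewrite -dY; exists w.
have R_extend i q : q < #|A| ^ i -> (exists t, R i q t) ->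
    exists2 a, a < #|A| & exists t, R i.+1 (q + a * #|A| ^ i) t.
  move=> hq /RP[y Yy hy]; exists (y (elt i)); first by have [_] := YX y Yy; apply.
  apply/RP; exists y => // j; rewrite ltnS leq_eqVlt => /predU1P[->|ji].
    by rewrite digit_add //; have [_] := YX y Yy; apply.
  by rewrite digit_add_lt // hy.
pose f := greedy A_gt0 R0 R_extend.
have fY i : exists2 y, Y y & forall j, j < i -> y (elt j) = f j.
  have [q [/RP[y Yy hy] hf]] := greedyP A_gt0 R0 R_extend i.
  by exists y => // j ji; rewrite hy // /f hf.
have [idx hidx] := choice eltS.
pose x : fullshift G A := fun g => letter_at (x0 1%g) (f (idx g)).
(* Several numbers name the same element. A long enough prefix of [f] is read from one configuration
   of [Y], so [f] gives them equal letters. *)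
have f_elt n k : elt n = elt k -> f n = f k.
  move=> e; have [y _ hy] := fY (maxn n k).+1.
  by rewrite -!hy ?e // ltnS ?leq_maxl ?leq_maxr.
exists x; split.
  rewrite XE => q hq [g hg].
  (* The bound exceeds all indices that the pattern inspects, so on its translated domain [x]
     coincides with a configuration coming from [Y]. *)
  have [y /YX[]] := fY (\max_(h <- enum_fset (domf q)) idx (g^-1 * h)%g).+1.
  rewrite XE => /(_ q hq) + _ hy; apply; exists g => h; rewrite -hg /Defs.shift /x; congr letter_at.
  by rewrite -hy ?hidx // ltnS; apply: leq_bigmax_seq => //; exact: valP.
have hrec := @rec_greedy S A R _ A_gt0 (@recb_refuted S A _ _ M _ _ pr rules b_gt0 A_gt0) R0 R_extend.
apply: (rec_machine hrec) => w; rewrite -/f.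
have fw : f (word_code w) < #|A| by exact: greedy_lt.
have eltw : elt (word_code w) = word_eval w by rewrite /elt /element word_codeK.
rewrite /x -eltw (f_elt _ _ (hidx _)).
have -> : letter_at (x0 1%g) (f (word_code w)) = enum_val (Ordinal fw) by rewrite (enum_val_nth (x0 1%g : A)).
by rewrite enum_valK.
Qed.
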